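(* Let $\ell\ge2$, $k\in I=\{0,1,\dots,\ell\}$ and $\beta\in\mathsf Q^+$. If the block algebra $R^{\Lambda_k}(\beta)$ of type $C^{(1)}_\ell$ is nonzero, then its defect is non-negative.
   Context: Lie theory. Let $\ell\ge2$, $I=\{0,1,\dots,\ell\}$, and let $\mathsf A=(a_{ij})_{i,j\in I}$ be the affine Cartan matrix of type $C^{(1)}_\ell$: $a_{ii}=2$, $a_{01}=-1$, $a_{10}=-2$, $a_{\ell,\ell-1}=-1$, $a_{\ell-1,\ell}=-2$, $a_{j,j+1}=a_{j+1,j}=-1$ for $1\le j\le \ell-2$, all other entries $0$. Simple roots are $\alpha_i$, simple coroots $\alpha_i^\vee=h_i$, fundamental weights $\Lambda_i$ $(i\in I)$, with $\langle \alpha_i^\vee,\alpha_j\rangle=a_{ij}$ and $\langle\alpha_i^\vee,\Lambda_j\rangle=\delta_{ij}$. Put $\mathsf Q^+=\bigoplus_{i\in I}\mathbb Z_{\ge0}\alpha_i$. With $(d_0,\dots,d_\ell)=(2,1,\dots,1,2)$, there is a symmetric bilinear form, invariant under the Weyl group, on the weight lattice with $(\Lambda_i,\alpha_j)=d_j\delta_{ij}$ and $(\alpha_i,\alpha_j)=d_ia_{ij}$. Defect. The defect of $\beta\in\mathsf Q^+$ relative to $\Lambda$ is $\operatorname{def}_\Lambda(\beta)=(\Lambda,\beta)-\frac12(\beta,\beta)$. The defect of a nonzero block algebra $R^{\Lambda}(\beta)$ is $\operatorname{def}_\Lambda(\beta)$. Algebras. Let $\mathbb F$ be an algebraically closed field.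 Fix polynomials $\mathcal Q_{i,j}(u,v)\in\mathbb F[u,v]$ $(i,j\in I)$ with $\mathcal Q_{i,i}=0$ and, for $i\ne j$, $\mathcal Q_{i,j}(u,v)=\sum t_{i,j;p,q}u^pv^q$, the sum over $p,q\ge0$ with $p(\alpha_i,\alpha_i)+q(\alpha_j,\alpha_j)+2(\alpha_i,\alpha_j)=0$, where $t_{i,j;p,q}\in\mathbb F$, $t_{i,j;-a_{ij},0}\ne0$ and $\mathcal Q_{i,j}(u,v)=\mathcal Q_{j,i}(v,u)$. For a dominant integral weight $\Lambda$ and $n\ge0$, the cyclotomic quiver Hecke (KLR) algebra $R^\Lambda_n$ is the $\mathbb F$-algebra generated by $e(\nu)$ $(\nu\in I^n)$, $x_1,\dots,x_n$, $\psi_1,\dots,\psi_{n-1}$ subject to: $e(\nu)e(\nu')=\delta_{\nu,\nu'}e(\nu)$; $\sum_\nu e(\nu)=1$; $x_re(\nu)=e(\nu)x_r$; $\psi_re(\nu)=e(s_r\nu)\psi_r$; $x_rx_s=x_sx_r$; $\psi_rx_s=x_s\psi_r$ if $s\ne r,r+1$; $\psi_r\psi_s=\psi_s\psi_r$ if $|r-s|>1$; $x_r\psi_re(\nu)=(\psi_rx_{r+1}-\delta_{\nu_r,\nu_{r+1}})e(\nu)$; $x_{r+1}\psi_re(\nu)=(\psi_rx_r+\delta_{\nu_r,\nu_{r+1}})e(\nu)$; $\psi_r^2e(\nu)=\mathcal Q_{\nu_r,\nu_{r+1}}(x_r,x_{r+1})e(\nu)$; $(\psi_{r+1}\psi_r\psi_{r+1}-\psi_r\psi_{r+1}\psi_r)e(\nu)$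 equals $\frac{\mathcal Q_{\nu_r,\nu_{r+1}}(x_r,x_{r+1})-\mathcal Q_{\nu_r,\nu_{r+1}}(x_{r+2},x_{r+1})}{x_r-x_{r+2}}e(\nu)$ if $\nu_r=\nu_{r+2}$ and $0$ otherwise; and $x_1^{\langle\alpha^\vee_{\nu_1},\Lambda\rangle}e(\nu)=0$. Here $s_r$ swaps the entries in places $r$ and $r+1$. For $\beta\in\mathsf Q^+$ of height $n$ (sum of coefficients), let $I^\beta=\{\nu\in I^n:\alpha_{\nu_1}+\dots+\alpha_{\nu_n}=\beta\}$ and $e(\beta)=\sum_{\nu\in I^\beta}e(\nu)$, a central idempotent; the block algebra is $R^\Lambda(\beta)=R^\Lambda_ne(\beta)$. *)

(* Defs.v *)
From HB Require Import structures.
From mathcomp Require Import all_boot all_order all_algebra.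
From mathcomp Require Import perm generic_quotient ring_quotient.
From mathcomp Require Import boolp classical_sets.
From mathcomp Require Import monalg.

Set Implicit Arguments.
Unset Strict Implicit.
Unset Printing Implicit Defensive.

Import Order.TTheory GRing.Theory Num.Theory.

Local Open Scope ring_scope.
Local Open Scope quotient_scope.

Section RootData.
Variable l : nat.
Local Notation I := 'I_l.+1.

(* Only meaningful for l >= 2: for l = 1 the two cases giving -2 and the case
   giving -1 would overlap. *)
Definition cartan (i j : I) : int :=
  if i == j then 2
  else if ((i == 1 :> nat) && (j == 0 :> nat))
          || ((i.+1 == l)%N && (j == l :> nat)) then - 2
  else if (i.+1 == j)%N || (j.+1 == i)%N then - 1
  else 0.

Definition symd (i : I) : int :=
  if (i == 0 :> nat) || (i == l :> nat) then 2 else 1.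

(* An element of Q^+ is given by its coefficients on the simple roots. *)
Definition rootQ := {ffun I -> nat}.

Definition simple_root (i : I) : rootQ := [ffun j => (j == i : nat)].

Definition height (b : rootQ) : nat := (\sum_i b i)%N.

(* A dominant integral weight is given by its values on the simple coroots,
   that is, by its coefficients on the fundamental weights: the component along
   the null root plays no role in the pairings below. *)
Definition dom_weight := {ffun I -> nat}.

Definition fund_weight (k : I) : dom_weight := [ffun i => (i == k : nat)].

Definition form_simple (i j : I) : int := symd i * cartan i j.

Definition form_root (b c : rootQ) : int :=
  \sum_i \sum_j (b i)%:Z * (c j)%:Z * form_simple i j.

(* (Lambda, beta), from (Lambda_i, alpha_j) = d_j delta_ij *)
Definition form_weight_root (L : dom_weight) (b : rootQ) : int :=
  \sum_i (L i)%:Z * (b i)%:Z * symd i.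

Definition defect (L : dom_weight) (b : rootQ) : rat :=
  (form_weight_root L b)%:Q - 2^-1 * (form_root b b)%:Q.

End RootData.

Definition free_algebra (K : comNzRingType) (G : choiceType) :=
  {malg K[{fmonom G}]}.

Section FreeAlgebra.
Variables (K : comNzRingType) (G : choiceType).

HB.instance Definition _ := GRing.Lalgebra.on (free_algebra K G).

Lemma free_algebra_scalerAr (c : K) (x y : free_algebra K G) :
  c *: (x * y) = x * (c *: y).
Proof.
have cC : forall z : free_algebra K G, c *: z = z * c%:MP.
  move=> z; rewrite malgM_def fgmulgU malgZ_def.
  by apply: eq_bigr => k _; rewrite mulrC mulm1.
by rewrite !cC mulrA.
Qed.

HB.instance Definition _ :=
  GRing.Lalgebra_isAlgebra.Build K (free_algebra K G) free_algebra_scalerAr.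

Definition free_gen (g : G) : free_algebra K G := << fmu g >>.

End FreeAlgebra.

Section Presented.
Variables (K : comNzRingType) (A : algType K) (rel : A -> A -> Prop).

(* The two-sided ideal generated by the differences u - v with rel u v. *)
Inductive rel_ideal : A -> Prop :=
| rel_ideal0 : rel_ideal 0
| rel_idealD a u v b y :
    rel u v -> rel_ideal y -> rel_ideal (a * (u - v) * b + y).

Lemma rel_idealDr x y : rel_ideal x -> rel_ideal y -> rel_ideal (x + y).
Proof.
move=> Ix Iy; elim: Ix => [|a u v b z uv _ IH]; first by rewrite add0r.
by rewrite -addrA; apply: rel_idealD.
Qed.

Lemma rel_idealMM c x d : rel_ideal x -> rel_ideal (c * x * d).
Proof.
elim=> [|a u v b y uv _ IH]; first by rewrite mulr0 mul0r; exact: rel_ideal0.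
rewrite mulrDr mulrDl !mulrA -[c * a * _ * b * d]mulrA.
exact: rel_idealD.
Qed.

Definition rel_ideal_pred : {pred A} := fun x => `[< rel_ideal x >].

Lemma rel_ideal_closed : zmod_closed rel_ideal_pred.
Proof.
split=> [|x y /asboolP Ix /asboolP Iy]; apply/asboolP; first exact: rel_ideal0.
apply: rel_idealDr => //.
by rewrite -mulN1r -[_ * y]mulr1; apply: rel_idealMM.
Qed.

HB.instance Definition _ :=
  GRing.isZmodClosed.Build A rel_ideal_pred rel_ideal_closed.

(* The quotient may be the zero ring, whence a pzRingType only; algType would
   require 1 != 0, so compatibility of the scaling with the product is given
   by [presented_scalerAl] and [presented_scalerAr] instead. *)
Definition presented := Quotient.quot rel_ideal_pred.

HB.instance Definition _ := GRing.Zmodule.on presented.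

Definition presented_pi (x : A) : presented := \pi_(Quotient.quot rel_ideal_pred) x.

Lemma presented_piP x y :
  presented_pi x = presented_pi y <-> rel_ideal (x - y).
Proof.
rewrite /presented_pi; split=> [/eqP|Ixy].
  by rewrite -Quotient.idealrBE => /asboolP.
by apply/eqP; rewrite -Quotient.idealrBE; apply/asboolP.
Qed.

Lemma presented_rel u v : rel u v -> presented_pi u = presented_pi v.
Proof.
move=> uv; apply/presented_piP.
rewrite -[u - v]addr0 -[u - v]mulr1 -[u - v]mul1r.
by apply: rel_idealD => //; exact: rel_ideal0.
Qed.

Definition presented_repr (x : presented) : A :=
  repr (x : Quotient.quot rel_ideal_pred).

Lemma presented_reprK x : presented_pi (presented_repr x) = x.
Proof. exact: reprK. Qed.

Lemma presented_reprP x : rel_ideal (presented_repr (presented_pi x) - x).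
Proof. by apply/presented_piP; rewrite presented_reprK. Qed.

Lemma presented_pi0 : presented_pi 0 = 0.
Proof. by rewrite /presented_pi raddf0. Qed.

Lemma presented_piD x y :
  presented_pi (x + y) = presented_pi x + presented_pi y.
Proof. exact: raddfD. Qed.

Definition presented_one : presented := presented_pi 1.
Definition presented_mul (x y : presented) : presented :=
  presented_pi (presented_repr x * presented_repr y).
Definition presented_scale (c : K) (x : presented) : presented :=
  presented_pi (c *: presented_repr x).

Lemma presented_mulE x y :
  presented_mul (presented_pi x) (presented_pi y) = presented_pi (x * y).
Proof.
set x' := presented_repr (presented_pi x).
set y' := presented_repr (presented_pi y).
apply/presented_piP; rewrite -/x' -/y'.
have -> : x' * y' - x * y = 1 * (x' - x) * y' + x * (y' - y) * 1.
  by rewrite mul1r mulr1 mulrBl mulrBr addrA subrK.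
by apply: rel_idealDr; apply: rel_idealMM; exact: presented_reprP.
Qed.

Lemma presented_scaleE c x :
  presented_scale c (presented_pi x) = presented_pi (c *: x).
Proof.
apply/presented_piP; rewrite -scalerBr -mulr_algl -[_ * _]mulr1.
by apply: rel_idealMM; exact: presented_reprP.
Qed.

Lemma presented_mulA : associative presented_mul.
Proof.
move=> x y z; rewrite -[x]presented_reprK -[y]presented_reprK.
by rewrite -[z]presented_reprK !presented_mulE mulrA.
Qed.

Lemma presented_mul1 : left_id presented_one presented_mul.
Proof. by move=> x; rewrite -[x]presented_reprK presented_mulE mul1r. Qed.

Lemma presented_mulr1 : right_id presented_one presented_mul.
Proof. by move=> x; rewrite -[x]presented_reprK presented_mulE mulr1. Qed.

Lemma presented_mulDl : left_distributive presented_mul +%R.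
Proof.
move=> x y z; rewrite -[x]presented_reprK -[y]presented_reprK.
rewrite -[z]presented_reprK -presented_piD !presented_mulE -presented_piD.
by rewrite mulrDl.
Qed.

Lemma presented_mulDr : right_distributive presented_mul +%R.
Proof.
move=> x y z; rewrite -[x]presented_reprK -[y]presented_reprK.
rewrite -[z]presented_reprK -presented_piD !presented_mulE -presented_piD.
by rewrite mulrDr.
Qed.

HB.instance Definition _ := GRing.Zmodule_isPzRing.Build presented
  presented_mulA presented_mul1 presented_mulr1 presented_mulDl presented_mulDr.

Lemma presented_scaleA a b x :
  presented_scale a (presented_scale b x) = presented_scale (a * b) x.
Proof. by rewrite -[x]presented_reprK !presented_scaleE scalerA. Qed.

Lemma presented_scale1 : left_id 1 presented_scale.
Proof. by move=> x; rewrite -[x]presented_reprK presented_scaleE scale1r. Qed.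

Lemma presented_scaleDr : right_distributive presented_scale +%R.
Proof.
move=> c x y; rewrite -[x]presented_reprK -[y]presented_reprK.
by rewrite -presented_piD !presented_scaleE -presented_piD scalerDr.
Qed.

Lemma presented_scaleDl x : {morph presented_scale^~ x : a b / a + b}.
Proof.
move=> a b; rewrite -[x]presented_reprK !presented_scaleE.
by rewrite -presented_piD scalerDl.
Qed.

HB.instance Definition _ := GRing.Zmodule_isLmodule.Build K presented
  presented_scaleA presented_scale1 presented_scaleDr presented_scaleDl.

Lemma presented_scalerAl (c : K) (x y : presented) : c *: (x * y) = c *: x * y.
Proof.
rewrite -[x]presented_reprK -[y]presented_reprK /GRing.mul /GRing.scale /=.
by rewrite !(presented_mulE, presented_scaleE) scalerAl.
Qed.

Lemma presented_scalerAr (c : K) (x y : presented) : c *: (x * y) = x * (c *: y).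
Proof.
rewrite -[x]presented_reprK -[y]presented_reprK /GRing.mul /GRing.scale /=.
by rewrite !(presented_mulE, presented_scaleE) scalerAr.
Qed.

Lemma presented_pi_is_zmod_morphism : zmod_morphism presented_pi.
Proof. by move=> x y; exact: raddfB. Qed.

HB.instance Definition _ := GRing.isZmodMorphism.Build A presented presented_pi
  presented_pi_is_zmod_morphism.

Lemma presented_pi_is_monoid_morphism : monoid_morphism presented_pi.
Proof.
by split=> // x y; rewrite -presented_mulE.
Qed.

HB.instance Definition _ := GRing.isMonoidMorphism.Build A presented
  presented_pi presented_pi_is_monoid_morphism.

Lemma presented_pi_is_scalable : scalable presented_pi.
Proof. by move=> c x; rewrite -presented_scaleE. Qed.

HB.instance Definition _ := GRing.isScalable.Build K A presented *:%R
  presented_pi presented_pi_is_scalable.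

End Presented.

(* A polynomial in F[u, v] is an element Q of {poly {poly F}}, the coefficient
   of u^p v^q being Q`_p`_q: in the notation of polyXY, u is 'X and v is 'Y. *)

Definition klr_datum (F : fieldType) (l : nat)
    (Q : 'I_l.+1 -> 'I_l.+1 -> {poly {poly F}}) : Prop :=
  [/\ forall i, Q i i = 0,
      forall i j p q, i != j -> (Q i j)`_p`_q != 0 ->
        p%:Z * form_simple i i + q%:Z * form_simple j j
          + 2 * form_simple i j = 0,
      forall i j, i != j -> (Q i j)`_(`|- cartan i j|%N)`_0 != 0
    & forall i j, Q i j = swapXY (Q j i)].

Section Eval.
Variables (F : fieldType) (A : algType F).
Implicit Types (Q : {poly {poly F}}) (a b c : A).

Definition eval2 Q a b : A :=
  \sum_(p < size Q) \sum_(q < size Q`_p) Q`_p`_q *: (a ^+ p * b ^+ q).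

(* (Q(u, v) - Q(w, v)) / (u - w), written out using
   u^p - w^p = (u - w) * sum_(s < p) u^(p-1-s) w^s *)
Definition divdiff2 Q a b c : A :=
  \sum_(p < size Q) \sum_(q < size Q`_p)
    Q`_p`_q *: ((\sum_(s < p) a ^+ (p.-1 - s) * c ^+ s) * b ^+ q).

Lemma divdiff2P Q a b c : a * c = c * a ->
  (a - c) * divdiff2 Q a b c = eval2 Q a b - eval2 Q c b.
Proof.
move=> ac; rewrite /divdiff2 /eval2 mulr_sumr -sumrB; apply: eq_bigr => p _.
rewrite mulr_sumr -sumrB; apply: eq_bigr => q _.
rewrite -scalerAr -scalerBr -mulrBl mulrA; congr (_ *: (_ * _)).
case: (nat_of_ord p) => [|m] /=; first by rewrite big_ord0 mulr0 !expr0 subrr.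
by rewrite subrXX_comm.
Qed.

End Eval.

Section KLR.
Variables (F : fieldType) (l : nat).
Local Notation I := 'I_l.+1.
Variables (Q : I -> I -> {poly {poly F}}) (L : dom_weight l) (n : nat).

(* Positions and strands are numbered from 0, so x_(r+1) and psi_(r+1) are the
   generators [klr_x] and [klr_psi] of index r.  The crossing k : 'I_n.-1
   exchanges the positions [lpos k] = k and [rpos k] = k + 1. *)
Definition lpos (k : 'I_n.-1) : 'I_n := widen_ord (leq_pred n) k.

Lemma rpos_subproof (k : 'I_n.-1) : (k.+1 < n)%N.
Proof. by rewrite -ltn_predRL. Qed.

Definition rpos (k : 'I_n.-1) : 'I_n := Ordinal (rpos_subproof k).

Definition swap (k : 'I_n.-1) (nu : n.-tuple I) : n.-tuple I :=
  [tuple tnth nu (tperm (lpos k) (rpos k) r) | r < n].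

Definition klr_gen : choiceType := (n.-tuple I + 'I_n + 'I_n.-1)%type.

Local Notation A := (free_algebra F klr_gen).

Definition free_e (nu : n.-tuple I) : A := free_gen F (inl (inl nu) : klr_gen).
Definition free_x (r : 'I_n) : A := free_gen F (inl (inr r) : klr_gen).
Definition free_psi (k : 'I_n.-1) : A := free_gen F (inr k : klr_gen).

Local Notation e := free_e.
Local Notation x := free_x.
Local Notation psi := free_psi.

Inductive klr_rel : A -> A -> Prop :=
| klr_e_idem nu nu' : klr_rel (e nu * e nu') ((nu == nu')%:R * e nu)
| klr_e_sum : klr_rel (\sum_nu e nu) 1
| klr_xe r nu : klr_rel (x r * e nu) (e nu * x r)
| klr_psie k nu : klr_rel (psi k * e nu) (e (swap k nu) * psi k)
| klr_xx r s : klr_rel (x r * x s) (x s * x r)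
| klr_psix k s : s != lpos k -> s != rpos k ->
    klr_rel (psi k * x s) (x s * psi k)
| klr_psipsi (k k' : 'I_n.-1) : (k.+1 < k')%N || (k'.+1 < k)%N ->
    klr_rel (psi k * psi k') (psi k' * psi k)
| klr_xpsi_l k nu :
    klr_rel (x (lpos k) * psi k * e nu)
      ((psi k * x (rpos k) - (tnth nu (lpos k) == tnth nu (rpos k))%:R) * e nu)
| klr_xpsi_r k nu :
    klr_rel (x (rpos k) * psi k * e nu)
      ((psi k * x (lpos k) + (tnth nu (lpos k) == tnth nu (rpos k))%:R) * e nu)
| klr_psi2 k nu :
    klr_rel (psi k ^+ 2 * e nu)
      (eval2 (Q (tnth nu (lpos k)) (tnth nu (rpos k))) (x (lpos k)) (x (rpos k))
         * e nu)
| klr_braid (k k' : 'I_n.-1) nu : k' = k.+1 :> nat ->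
    klr_rel ((psi k' * psi k * psi k' - psi k * psi k' * psi k) * e nu)
      (if tnth nu (lpos k) == tnth nu (rpos k') then
         divdiff2 (Q (tnth nu (lpos k)) (tnth nu (rpos k)))
           (x (lpos k)) (x (rpos k)) (x (rpos k')) * e nu
       else 0)
| klr_cyclotomic (r : 'I_n) nu : r = 0 :> nat ->
    klr_rel (x r ^+ L (tnth nu r) * e nu) 0.

Definition klr_algebra := presented klr_rel.

HB.instance Definition _ := GRing.PzRing.on klr_algebra.
HB.instance Definition _ := GRing.Lmodule.on klr_algebra.

Definition klr_pi (a : A) : klr_algebra := presented_pi klr_rel a.

Definition klr_e (nu : n.-tuple I) : klr_algebra := klr_pi (e nu).
Definition klr_x (r : 'I_n) : klr_algebra := klr_pi (x r).
Definition klr_psi (k : 'I_n.-1) : klr_algebra := klr_pi (psi k).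

Definition content (nu : n.-tuple I) : rootQ l :=
  \sum_(r < n) simple_root (tnth nu r).

Definition klr_e_root (b : rootQ l) : klr_algebra :=
  \sum_(nu : n.-tuple I | content nu == b) klr_e nu.

End KLR.

Definition block_algebra (F : fieldType) (l : nat)
    (Q : 'I_l.+1 -> 'I_l.+1 -> {poly {poly F}})
    (L : dom_weight l) (b : rootQ l) : set (klr_algebra Q L (height b)) :=
  [set a * klr_e_root Q L (height b) b | a in setT]%classic.

Arguments block_algebra {F l} Q L b _.

(* Main.v *)
(* The proof takes place inside the single algebra R^Lambda_n, for an arbitrary
   dominant weight Lambda, and looks at the prefixes s of the sequences nu with
   e(nu) != 0.  Fix a colour i.  Pulling a strand coloured i, placed just after
   s, to the far left and back gives 0 by the cyclotomic relation.  Resolving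
   the crossings one at a time shows that this vanishing element is
     sum u psi u' + p(x),
   where x belongs to the pulled strand, the u' bring a strand coloured i to the
   end of s, and where the Laurent series in X^-1 with polynomial part p(X) and
   negative part sum u (X - x')^-1 u' (x' for the last strand of s) is obtained
   from X^Lambda(h_i) by multiplying with Q_ij(X, x_r) for each strand r
   coloured j <> i, and with - (X - x_r)^-2 for each strand r coloured i.  It has
   an invertible leading coefficient, in degree <h_i, Lambda - |s|>.
   Suppose now that s is followed by r strands coloured i and that no sequence
   e(nu) != 0 obtained by permuting the prefix has more.  Then u' = 0, so the
   degree is nonnegative, and p kills the first of the r strands; by taking
   divided differences, r is at most the degree.  Hence if
   <h_i, Lambda - beta> < 0, removing these r strands gives a shorter prefix
   whose defect is not larger.  One ends with Lambda - beta dominant, and then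
   the defect (beta, Lambda + (Lambda - beta)) / 2 is nonnegative. *)

From HB Require Import structures.
Require Import Defs.
From mathcomp Require Import all_boot all_order all_algebra perm.
From mathcomp Require Import boolp classical_sets.
From mathcomp Require Import ring zify.

Set Implicit Arguments.
Unset Strict Implicit.
Unset Printing Implicit Defensive.

Import Order.TTheory GRing.Theory Num.Theory.

Local Open Scope ring_scope.

(** * Complete homogeneous sums, polynomial quotients and nilHecke relations *)

Section Convolution.
Variable R : pzRingType.
Implicit Types (x y e : R) (g p : nat -> R).

(** For [g = GRing.exp z] with [z] commuting with [y], this is the complete homogeneous polynomial
    of degree [m - 1] in [y] and [z], that is, the divided difference of $X^m$; it is 0 for
    [m = 0]. *)
Definition conv y g m : R := \sum_(a < m) y ^+ (m.-1 - a) * g a.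

Lemma conv0 y g : conv y g 0 = 0.
Proof. by rewrite /conv big_ord0. Qed.

Lemma convS y g m : conv y g m.+1 = y * conv y g m + g m.
Proof.
rewrite /conv big_ord_recr /= subnn mul1r mulr_sumr; congr (_ + _).
apply: eq_bigr => a _; rewrite mulrA -exprS; congr (_ ^+ _ * _).
by case: m a => [[]//|m] a /=; rewrite subSn // -ltnS.
Qed.

Lemma convC x y m : GRing.comm x y ->
  conv x (GRing.exp y) m.+1 = y * conv x (GRing.exp y) m + x ^+ m.
Proof.
move=> cxy; rewrite /conv big_ord_recl /= mulr1 subn0 addrC; congr (_ + _).
rewrite mulr_sumr; apply: eq_bigr => a _; rewrite /bump /= add1n exprS.
by rewrite !mulrA [y * _](commrX _ (commr_sym cxy)) subnS predn_sub.
Qed.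

(** The polynomial part of $X^{-k}p(X)$ at [y], once [p] vanishes from [D] on. So [k = 0] gives
    $p(y)$, and the values at [k.+1] are the coefficients of the quotient $(p(X)-p(y))/(X-y)$. *)
Definition tail p D y k : R := \sum_(a < D) p (k + a)%N * y ^+ a.

Lemma tail_ge p D y k : (forall m, (D <= m)%N -> p m = 0) ->
  (D <= k)%N -> tail p D y k = 0.
Proof.
move=> p0 lek; rewrite /tail big1 // => a _.
by rewrite p0 ?mul0r // (leq_trans lek) // leq_addr.
Qed.

Lemma tailS p D y k : (forall m, (D <= m)%N -> p m = 0) ->
  tail p D y k = p k + tail p D y k.+1 * y.
Proof.
move=> p0; have: tail p D.+1 y k = tail p D y k.
  by rewrite /tail big_ord_recr /= [p _]p0 ?mul0r ?addr0 // leq_addl.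
move<-; rewrite /tail big_ord_recl /= addn0 mulr1 mulr_suml; congr (_ + _).
by apply: eq_bigr => a _; rewrite /bump /= add1n exprSr mulrA addSnnS.
Qed.

Lemma comm_tail p D y k u : (forall m, GRing.comm (p m) u) -> GRing.comm y u ->
  GRing.comm (tail p D y k) u.
Proof.
move=> cp cy; rewrite /tail; apply/commr_sym.
elim/big_ind: _ => [|v w|b _]; [exact: commr0|exact: commrD|].
by apply: commrM; [exact/commr_sym/cp|exact/commrX/commr_sym].
Qed.

(* Summation by parts. *)
Lemma sum_conv p D y g : (forall m, (D <= m)%N -> p m = 0) ->
  \sum_(m < D) p m * conv y g m = \sum_(a < D) tail p D y a.+1 * g a.
Proof.
move=> p0.
suff H M : \sum_(m < M) p m * conv y g m + tail p D y M * conv y g M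
    = \sum_(a < M) tail p D y a.+1 * g a.
  by rewrite -H (tail_ge _ p0) // mul0r addr0.
elim: M => [|M IH]; first by rewrite !big_ord0 conv0 mulr0 addr0.
rewrite !big_ord_recr /= -IH convS mulrDr (tailS _ M p0) mulrDl !mulrA.
by rewrite !addrA.
Qed.

(** Between different colours a power passes the crossing without error term, and the two crossings
    then meet. *)
Lemma psi_expr_psi_slide y z psi t E m : GRing.comm z E ->
    y * psi * E = psi * z * E -> psi * psi * E = t * E ->
  psi * y ^+ m * psi * E = t * z ^+ m * E.
Proof.
move=> czE ypz psi2; have czmE k := commrX k (commr_sym czE).
have {ypz}slide k : y ^+ k * psi * E = psi * z ^+ k * E.
  elim: k => [|k IH]; first by rewrite mul1r mulr1.
  rewrite exprS -!mulrA [y ^+ k * _]mulrA IH -[psi * _ * _]mulrA -czmE !mulrA.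
  by rewrite ypz -mulrA czmE mulrA -[psi * z * _]mulrA -exprS.
rewrite -!mulrA [y ^+ m * _]mulrA slide -[psi * _ * _]mulrA -czmE !mulrA.
by rewrite psi2 -mulrA czmE mulrA.
Qed.

(* [E] plays the role of an idempotent whose two strands carry the same
   colour. *)
Section SameColour.
Variables x y psi E : R.
Hypotheses (cxy : GRing.comm x y) (cxE : GRing.comm x E) (cyE : GRing.comm y E)
  (cpE : GRing.comm psi E) (psi2 : psi * psi * E = 0)
  (ypsi : y * psi * E = (psi * x + 1) * E)
  (xpsi : x * psi * E = (psi * y - 1) * E).

Local Notation h := (conv x (GRing.exp y)).

(** Between equal colours, passing the crossing leaves the divided difference as error term. *)
Lemma expr_psi m : y ^+ m * psi * E = (psi * x ^+ m + h m) * E.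
Proof.
elim: m => [|m IH]; first by rewrite expr0 mul1r mulr1 conv0 addr0.
have ypx : y * psi * x ^+ m * E = (psi * x ^+ m.+1 + x ^+ m) * E.
  rewrite -mulrA -(commrX m (commr_sym cxE)) mulrA ypsi -mulrA.
  by rewrite (commrX m (commr_sym cxE)) mulrA mulrDl mul1r -mulrA -exprS.
rewrite convC // exprS -!mulrA [y ^+ m * _]mulrA IH mulrA mulrDr mulrDl.
by rewrite mulrA ypx !mulrDl addrAC addrA.
Qed.

(** The term containing [psi * psi] dies, so only the divided difference survives; its sign comes
    from [psi * x = y * psi - 1] on [E]. *)
Lemma psi_expr_psi m : psi * x ^+ m * psi * E = - h m * psi * E.
Proof.
elim: m => [|m IH]; first by rewrite expr0 mulr1 conv0 oppr0 !mul0r.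
have -> : psi * x ^+ m.+1 * psi * E = (psi * x * E) * (x ^+ m * psi).
  rewrite exprS -!mulrA; congr (_ * (_ * _)).
  by rewrite [RHS]mulrA (commrX m (commr_sym cxE)) -mulrA cpE.
have -> : psi * x * E = (y * psi - 1) * E by rewrite mulrBl ypsi mulrDl addrK.
rewrite -mulrA [E * _]mulrA (commrX m (commr_sym cxE)) -mulrA -cpE.
rewrite mulrBl mul1r -mulrA [psi * _]mulrA [psi * _ * _]mulrA IH.
rewrite convC // opprD !mulrDl !mulNr mulrN !mulrA.
by [].
Qed.

Lemma psi_expr_psi' m : psi * y ^+ m * psi * E = h m * psi * E.
Proof.
elim: m => [|m IH]; first by rewrite expr0 mulr1 conv0 !mul0r.
have -> : psi * y ^+ m.+1 * psi * E = (psi * y * E) * (y ^+ m * psi).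
  rewrite exprS -!mulrA; congr (_ * (_ * _)).
  by rewrite [RHS]mulrA (commrX m (commr_sym cyE)) -mulrA cpE.
have -> : psi * y * E = (x * psi + 1) * E by rewrite mulrDl xpsi mulrBl subrK.
rewrite -mulrA [E * _]mulrA (commrX m (commr_sym cyE)) -mulrA -cpE.
rewrite mulrDl mul1r -mulrA [psi * _]mulrA [psi * _ * _]mulrA IH.
by rewrite convS !mulrDl !mulrA.
Qed.

(** Peeling off [y] rather than [x], by [convC], gives a recurrence that can be summed over the
    pairs of a loop, whose entries commute with [y]. *)
Lemma psi_expr_psi'S m :
  psi * y ^+ m.+1 * psi * E = (y * (psi * y ^+ m * psi) + x ^+ m * psi) * E.
Proof.
by rewrite psi_expr_psi' convC // !mulrDl -[y * _ * E]mulrA psi_expr_psi' !mulrA.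
Qed.

End SameColour.
End Convolution.

(** * Evaluation of polynomials in a possibly zero ring, through a scalar morphism *)

Section PolyEval.
Variables (F : fieldType) (R : pzRingType) (sc : {rmorphism F -> R}).
Implicit Types (P : {poly F}) (Q : {poly {poly F}}) (x y : R).

Definition ev P y : R := \sum_(q < size P) sc P`_q * y ^+ q.

Definition ev2 Q x y : R := \sum_(m < size Q) ev Q`_m y * x ^+ m.

Lemma evE P y d : (size P <= d)%N -> ev P y = \sum_(q < d) sc P`_q * y ^+ q.
Proof.
move=> le; rewrite /ev (big_ord_widen _ (fun q => sc P`_q * y ^+ q) le) big_mkcond.
apply: eq_bigr => q _; case: ltnP => // le'.
by rewrite nth_default // raddf0 mul0r.
Qed.

Lemma ev0 y : ev 0 y = 0.
Proof. by rewrite /ev size_poly0 big_ord0. Qed.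

Lemma evC c y : ev c%:P y = sc c.
Proof.
by rewrite (evE _ (size_polyC_leq1 c)) big_ord1 coefC /= expr0 mulr1.
Qed.

Lemma ev2E Q x y d : (size Q <= d)%N ->
  ev2 Q x y = \sum_(m < d) ev Q`_m y * x ^+ m.
Proof.
move=> le; rewrite /ev2 (big_ord_widen _ (fun q => ev Q`_q y * x ^+ q) le).
rewrite big_mkcond; apply: eq_bigr => q _; case: ltnP => // le'.
by rewrite nth_default // ev0 mul0r.
Qed.

Lemma ev2_swapXY Q x y : GRing.comm x y -> ev2 (swapXY Q) x y = ev2 Q y x.
Proof.
move=> cxy.
(* A common bound on all degrees, so that both double sums run over the same square. *)
pose d := (maxn (maxn (size Q) (size (swapXY Q)))
  (maxn (\max_(m < size Q) size (Q`_m)%R)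
        (\max_(m < size (swapXY Q)) size ((swapXY Q)`_m)%R)))%N.
have sz (P : {poly {poly F}}) : (size P <= d)%N ->
    (\max_(m < size P) size (P`_m)%R <= d)%N -> forall m, (size (P`_m)%R <= d)%N.
  move=> _ le m; case: (ltnP m (size P)) => [lt|ge]; last first.
    by rewrite nth_default // size_poly0.
  exact: leq_trans (leq_bigmax (Ordinal lt)) le.
have sQ : (size Q <= d)%N by rewrite !leq_max leqnn.
have sS : (size (swapXY Q) <= d)%N by rewrite !leq_max leqnn orbT.
have mQ m : (size (Q`_m)%R <= d)%N.
  by apply: sz; rewrite // !leq_max leqnn ?orbT.
have mS m : (size ((swapXY Q)`_m)%R <= d)%N.
  by apply: sz; rewrite // !leq_max leqnn ?orbT.

rewrite (ev2E _ _ sQ) (ev2E _ _ sS).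
under eq_bigr => m _ do rewrite (evE _ (mS _)) mulr_suml.
rewrite exchange_big; apply: eq_bigr => m _ /=.
rewrite (evE _ (mQ _)) mulr_suml.
apply: eq_bigr => q _; rewrite coef_swapXY -!mulrA; congr (_ * _).
by apply: commrX; apply: commr_sym; apply: commrX.
Qed.

End PolyEval.

(** * Resolution of a strand pulled to the far left and back *)

Section Loop.
Variables (F : fieldType) (l : nat).
Local Notation I := 'I_l.+1.
Variables (Q : I -> I -> {poly {poly F}}) (L : dom_weight l).

(* The relations of a cyclotomic KLR algebra, with [E nu] for a sequence [nu]
   of unspecified length, so that prefixes and suffixes are handled by
   concatenation; the places are numbered from 0. *)
Record klr_system (R : pzRingType) (sc : {rmorphism F -> R}) (X Psi : nat -> R)
    (E : seq I -> R) : Prop := KlrSystem {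
  sys_sc : forall c y, GRing.comm (sc c) y;
  sys_XX : forall r s, GRing.comm (X r) (X s);
  sys_PsiX : forall k s, s != k -> s != k.+1 -> GRing.comm (Psi k) (X s);
  sys_PsiPsi : forall k k', (k.+1 < k')%N -> GRing.comm (Psi k) (Psi k');
  sys_XE : forall r s, GRing.comm (X r) (E s);
  sys_PsiE : forall p a b q,
    Psi (size p) * E (p ++ a :: b :: q) = E (p ++ b :: a :: q) * Psi (size p);
  sys_XPsi_l : forall p a b q,
    X (size p) * Psi (size p) * E (p ++ a :: b :: q)
    = (Psi (size p) * X (size p).+1 - (a == b)%:R) * E (p ++ a :: b :: q);
  sys_XPsi_r : forall p a b q,
    X (size p).+1 * Psi (size p) * E (p ++ a :: b :: q)
    = (Psi (size p) * X (size p) + (a == b)%:R) * E (p ++ a :: b :: q);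
  sys_Psi2 : forall p a b q,
    Psi (size p) * Psi (size p) * E (p ++ a :: b :: q)
    = ev2 sc (Q a b) (X (size p)) (X (size p).+1) * E (p ++ a :: b :: q);
  sys_braid : forall p a b q,
    Psi (size p).+1 * Psi (size p) * Psi (size p).+1 * E (p ++ a :: b :: a :: q)
    = (Psi (size p) * Psi (size p).+1 * Psi (size p)
       + \sum_(m < size (Q a b)) ev sc (Q a b)`_m (X (size p).+1)
           * conv (X (size p)) (GRing.exp (X (size p).+2)) m)
      * E (p ++ a :: b :: a :: q);
  sys_cyclotomic : forall a q, X 0 ^+ L a * E (a :: q) = 0 }.

Hypothesis hQ : klr_datum Q.
Variables (R : pzRingType) (sc : {rmorphism F -> R}) (X Psi : nat -> R)
  (E : seq I -> R).
Hypothesis sys : klr_system sc X Psi E.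

Let cXX := sys_XX sys.
Let cXE := sys_XE sys.
Let csc := sys_sc sys.

(** Replaces membership in the subalgebra generated on the first [n] strands. *)
Definition local n (u : R) : Prop := forall r, (n <= r)%N ->
  GRing.comm u (X r) /\ GRing.comm u (Psi r).

Lemma localW m n u : (m <= n)%N -> local m u -> local n u.
Proof. by move=> le loc r ler; apply: loc; apply: leq_trans ler. Qed.

Lemma local0 n : local n 0.
Proof. by move=> r _; split; apply/commr_sym/commr0. Qed.

Lemma local1 n : local n 1.
Proof. by move=> r _; split; apply/commr_sym/commr1. Qed.

Lemma local_sc n c : local n (sc c).
Proof. by move=> r _; split. Qed.

Lemma localN n u : local n u -> local n (- u).
Proof.
by move=> loc r /loc[cu cv]; split; apply/commr_sym/commrN/commr_sym.
Qed.

Lemma localD n u v : local n u -> local n v -> local n (u + v).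
Proof.
move=> lu lv r ler; have [uX uP] := lu r ler; have [vX vP] := lv r ler.
by split; apply/commr_sym/commrD; apply/commr_sym.
Qed.

Lemma localM n u v : local n u -> local n v -> local n (u * v).
Proof.
move=> lu lv r ler; have [uX uP] := lu r ler; have [vX vP] := lv r ler.
by split; apply/commr_sym/commrM; apply/commr_sym.
Qed.

Lemma local_sum n (J : Type) (r : seq J) (P : pred J) (f : J -> R) :
  (forall j, P j -> local n (f j)) -> local n (\sum_(j <- r | P j) f j).
Proof.
move=> loc; elim/big_ind: _ => //; [exact: local0|exact: localD].
Qed.

Lemma local_exp n u k : local n u -> local n (u ^+ k).
Proof.
move=> lu; elim: k => [|k IH]; first exact: local1.
by rewrite exprS; apply: localM.
Qed.

Lemma localX n r : (r < n)%N -> local n (X r).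
Proof.
move=> lt s le; split=> //; apply/commr_sym/(sys_PsiX sys); lia.
Qed.

Lemma localPsi n r : (r.+1 < n)%N -> local n (Psi r).
Proof.
move=> lt s le; split; first by apply: (sys_PsiX sys); lia.
by apply: (sys_PsiPsi sys); lia.
Qed.

Lemma local_ev n P y : local n y -> local n (ev sc P y).
Proof.
move=> ly; apply: local_sum => q _; apply: localM; first exact: local_sc.
exact: local_exp.
Qed.

Lemma local_tail n p D y k : (forall m, local n (p m)) -> local n y ->
  local n (tail p D y k).
Proof.
by move=> lp ly; apply: local_sum => a _; apply: localM => //; apply: local_exp.
Qed.


(** [b] lists the coefficients of a Laurent series in $X^{-1}$, and [a], [c] are its degree and
    leading coefficient after multiplication by [e]; that [c] is nonzero is imposed in
    [loop_lead]. *)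
Definition leads (b : int -> R) (a : int) (c : F) (e : R) : Prop :=
  b a * e = sc c * e /\ forall z, a < z -> b z * e = 0.

(** The recurrence says $(X-y)B_1=B$ for the two series (times [e]). Since $B_1$ vanishes in high
    degree, it is the expansion of $B/(X-y)$ at infinity, of degree one less and with the same
    leading coefficient. *)
Lemma leads_div b b1 a c (e y : R) (D : nat) :
    (forall m, (D <= m)%N -> b1 (Posz m) * e = 0) ->
    (forall z, b1 (z - 1) * e = y * (b1 z * e) + b z * e) ->
  leads b a c e -> leads b1 (a - 1) c e.
Proof.
move=> b10 b1S [ba bz].
have b1z z : a - 1 < z -> b1 z * e = 0.
  move=> ltz; have: D%:Z <= z + `|D%:Z - z|%N by lia.
  move: `|_|%N => k.
  elim: k z ltz => [|k IH] z ltz lez.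
    by case: z lez ltz => // m lez _; apply: b10; lia.
  have -> : z = z + 1 - 1 by rewrite addrK.
  rewrite b1S IH ?mulr0 ?add0r; last 2 first.
  - by lia.
  - by lia.
  by rewrite bz //; lia.
split=> //; rewrite b1S b1z ?mulr0 ?add0r //; lia.
Qed.

Lemma leadsN b a c e : leads b a c e -> leads (fun z => - b z) a (- c) e.
Proof.
move=> [ba bz]; split=> [|z /bz]; first by rewrite mulNr ba raddfN mulNr.
by rewrite mulNr => ->; rewrite oppr0.
Qed.

Lemma comm_ev u P y : GRing.comm u y -> GRing.comm u (ev sc P y).
Proof.
move=> cuy; rewrite /ev; elim/big_ind: _ => [|v w|q _]; first exact: commr0.
  exact: commrD.
by apply: commrM; [apply/commr_sym/csc|apply: commrX].
Qed.

Lemma leads_ext b b' a c e : b =1 b' -> leads b a c e -> leads b' a c e.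
Proof. by move=> bb' [ba bz]; split=> [|z]; rewrite -bb'; last exact: bz. Qed.

Section FixedColour.
Variable i : I.

Definition wsum (U : seq (R * R)) (A : R) : R := \sum_(w <- U) w.1 * A * w.2.

Lemma wsum0 U : wsum U 0 = 0.
Proof. by rewrite /wsum big1 // => w _; rewrite mulr0 mul0r. Qed.

Lemma wsumD U A B : wsum U (A + B) = wsum U A + wsum U B.
Proof.
by rewrite /wsum -big_split; apply: eq_bigr => w _; rewrite mulrDr mulrDl.
Qed.

Lemma wsumN U A : wsum U (- A) = - wsum U A.
Proof.
by rewrite /wsum -sumrN; apply: eq_bigr => w _; rewrite mulrN mulNr.
Qed.

Lemma wsum_sum U (J : Type) (r : seq J) (f : J -> R) :
  wsum U (\sum_(j <- r) f j) = \sum_(j <- r) wsum U (f j).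
Proof.
rewrite /wsum exchange_big /=; apply: eq_bigr => w _.
by rewrite mulr_sumr mulr_suml.
Qed.

Lemma wsumMr U A y : {in U, forall w, GRing.comm w.2 y} ->
  wsum U (A * y) = wsum U A * y.
Proof.
move=> cy; rewrite /wsum mulr_suml; apply: eq_big_seq => w /cy cw.
by rewrite mulrA -!mulrA cw.
Qed.

Lemma wsumMl U A y : {in U, forall w, GRing.comm w.1 y} ->
  wsum U (y * A) = y * wsum U A.
Proof.
move=> cy; rewrite /wsum mulr_sumr; apply: eq_big_seq => w /cy cw.
by rewrite !mulrA cw.
Qed.

(* [U] lists pairs (u, u') of elements on the strands of [s], where u' brings
   a strand coloured [i] to the last place of [s]. *)
Definition pulls (s : seq I) (U : seq (R * R)) : Prop :=
  {in U, forall w, [/\ local (size s) w.1, local (size s) w.2 &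
    exists s', perm_eq (rcons s' i) s
      /\ forall q, w.2 * E (s ++ q) = E (s' ++ i :: q) * w.2]}.

Lemma pulls_commX1 s U r : pulls s U -> (size s <= r)%N ->
  {in U, forall w, GRing.comm w.1 (X r)}.
Proof. by move=> pU le w /pU[l1 _ _]; case: (l1 r le). Qed.

Lemma pulls_commX2 s U r : pulls s U -> (size s <= r)%N ->
  {in U, forall w, GRing.comm w.2 (X r)}.
Proof. by move=> pU le w /pU[_ l2 _]; case: (l2 r le). Qed.

(** Each [u'] brings a strand coloured [i] to the end of [s], so the middle factor may be rewritten
    by relations that hold for such a last strand. *)
Lemma wsum_sandwich s U A B q : pulls s U ->
    (forall s', size s = (size s').+1 ->
      A * E (s' ++ i :: q) = B * E (s' ++ i :: q)) ->
  wsum U A * E (s ++ q) = wsum U B * E (s ++ q).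
Proof.
move=> pU AB; rewrite /wsum !mulr_suml; apply: eq_big_seq => w /pU[_ _ [s' [ps es]]].
rewrite -!mulrA es; congr (_ * _); rewrite !mulrA AB //.
by rewrite -(perm_size ps) size_rcons.
Qed.

Lemma local_wsum s U A n : pulls s U -> (size s <= n)%N -> local n A ->
  local n (wsum U A).
Proof.
move=> pU le lA; rewrite /wsum big_seq; apply: local_sum => w /pU[l1 l2 _].
by apply: localM; [apply: localM|] => //; apply: localW le _.
Qed.

(* The Laurent series in the inverse of an indeterminate whose polynomial part
   is [p] and whose coefficient of exponent -1 - k is the bubble
   sum of u x^k u'. *)
Definition lser U p n (z : int) : R :=
  match z with Posz m => p m | Negz k => wsum U (X n.-1 ^+ k) end.

(** [loop_zero] is the resolved cyclotomic relation, with [p] evaluated at the pulled strand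
    [X (size s)]. The degree [a] may be negative; then every [E (s ++ q)] kills all coefficients of
    [p]. *)
Record loop (s : seq I) (a : int) (U : seq (R * R)) (p : nat -> R) (D : nat) :
    Prop := Loop {
  loop_pulls : pulls s U;
  loop_local : forall m, local (size s) (p m);
  loop_bound : forall m, (D <= m)%N -> p m = 0;
  loop_zero : forall q,
    (wsum U (Psi (size s).-1) + tail p D (X (size s)) 0) * E (s ++ i :: q) = 0;
  loop_lead : exists2 c, c != 0 &
    forall q, leads (lser U p (size s)) a c (E (s ++ q)) }.

Lemma loop_nil : exists U p D, loop [::] (L i)%:Z U p D.
Proof.
(* The series is $X^{\langle h_i,\Lambda\rangle}$; there is no strand to exchange, hence no pair. *)
exists [::], (fun m => (m == L i)%:R), (L i).+1.
split=> [w|m|m lem|q|]; first by rewrite in_nil.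
- by case: eqP => _; [exact: local1|exact: local0].
- by case: eqP => // lem'; lia.
- rewrite /wsum big_nil add0r /tail /= big_ord_recr /= eqxx mul1r big1 ?add0r.
    exact: (sys_cyclotomic sys).
  by move=> a _; rewrite add0n ltn_eqF // mul0r.
exists 1; first exact: oner_neq0.
move=> q; split=> [|[m|k]] /=; first by rewrite eqxx rmorph1.
  by move=> lt; rewrite gtn_eqF ?mul0r.
by [].
Qed.

(** * A new strand of the same colour: multiplication of the series by $-(X-y)^{-2}$ *)

Section SameColourStep.
Variables (s : seq I) (a : int) (U : seq (R * R)) (p : nat -> R) (D : nat).
Hypothesis lp : loop s a U p D.
Local Notation n := (size s).
Local Notation x := (X n.-1).
Local Notation phi := (Psi n.-1).
Local Notation y := (X n).

Let pU := loop_pulls lp.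
Let p0 := loop_bound lp.

Lemma comm_pX m r : (n <= r)%N -> GRing.comm (p m) (X r).
Proof. by move=> /(loop_local lp m)[]. Qed.

Lemma comm_tailX k r : (n <= r)%N -> GRing.comm (tail p D y k) (X r).
Proof. by move=> le; apply: comm_tail => [m|]; [exact: comm_pX|]. Qed.

(** [bub] gives the negative part of the old series, [half] that of the series divided once by
    $X-y$, up to sign, and [full] enters after the second division. *)
Definition bub j := wsum U (x ^+ j).
Definition half j := wsum U (x ^+ j * phi).
Definition full j := wsum U (phi * y ^+ j * phi).

Lemma comm_bub j : GRing.comm y (bub j).
Proof.
rewrite /GRing.comm /bub -(wsumMl _ (pulls_commX1 pU (leqnn _))).
by rewrite -(wsumMr _ (pulls_commX2 pU (leqnn _))) -(commrX j (cXX n n.-1)).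
Qed.

(** The vanishing relation glues the two parts of the series: the remainder $p(y)$ of the polynomial
    division becomes the coefficient of $X^{-1}$. *)
Lemma half0 q : half 0 * E (s ++ i :: q) = - tail p D y 0 * E (s ++ i :: q).
Proof.
have /eqP := loop_zero lp q; rewrite mulrDl addr_eq0 => /eqP H.
by rewrite /half expr0 mul1r H mulNr.
Qed.

Lemma halfS j q : half j.+1 * E (s ++ i :: q)
  = half j * y * E (s ++ i :: q) - bub j * E (s ++ i :: q).
Proof.
have -> : half j.+1 * E (s ++ i :: q)
    = wsum U (x ^+ j * phi * y - x ^+ j) * E (s ++ i :: q).
  apply: wsum_sandwich => // s' ->; rewrite /= exprSr -!mulrA.
  have := sys_XPsi_l sys s' i i q; rewrite eqxx -mulrA => ->.
  by rewrite mulrA mulrBr mulr1 mulrA.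
by rewrite wsumD wsumN mulrBl (wsumMr _ (pulls_commX2 pU (leqnn _))).
Qed.

Lemma comm_half j q : GRing.comm y (half j * E (s ++ i :: q)).
Proof.
elim: j => [|j IH].
  rewrite half0; apply: commrM; last exact: cXE.
  exact/commrN/commr_sym/comm_tailX.
rewrite halfS -mulrA cXE mulrA; apply: commrB; first exact: commrM.
by apply: commrM; [exact: comm_bub|exact: cXE].
Qed.

Lemma halfS' j q : half j.+1 * E (s ++ i :: q)
  = y * (half j * E (s ++ i :: q)) - bub j * E (s ++ i :: q).
Proof.
by rewrite halfS comm_half -[half j * y * _]mulrA cXE mulrA.
Qed.

Lemma same_colour_rels (k : nat) s' q : size s' = k ->
  let e := E (s' ++ i :: i :: q) in
  [/\ GRing.comm (Psi k) e, Psi k * Psi k * e = 0,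
      X k.+1 * Psi k * e = (Psi k * X k + 1) * e &
      X k * Psi k * e = (Psi k * X k.+1 - 1) * e].
Proof.
move=> <- e; have [Qii _ _ _] := hQ.
have := sys_XPsi_l sys s' i i q; have := sys_XPsi_r sys s' i i q.
rewrite eqxx => er el; split=> //; first exact: (sys_PsiE sys).
by rewrite /e (sys_Psi2 sys) Qii /ev2 size_poly0 big_ord0 mul0r.
Qed.

Lemma full0 q : full 0 * E (s ++ i :: q) = 0.
Proof.
rewrite (@wsum_sandwich s U _ 0) // ?wsum0 ?mul0r // => s' ->.
have [_ e2 _ _] := same_colour_rels q (erefl (size s')).
by rewrite expr0 mulr1 mul0r.
Qed.

Lemma fullS j q : full j.+1 * E (s ++ i :: q)
  = y * (full j * E (s ++ i :: q)) + half j * E (s ++ i :: q).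
Proof.
rewrite mulrA -(wsumMl _ (pulls_commX1 pU (leqnn _))) -mulrDl -wsumD.
apply: wsum_sandwich => // s' ->.
have [cp e2 er el] := same_colour_rels q (erefl (size s')).
exact: (psi_expr_psi'S (cXX _ _) (cXE _ _) cp e2 el).
Qed.

(** [p1] and [- p'] are the successive polynomial quotients by $X-y$. [U'] extends the old pairs
    across the new strand, and adds pairs in which the new strand itself, already coloured [i], is
    the one singled out. *)
Let p1 k := tail p D y k.+1.
Let p' k := - tail p1 D y k.+1.
Let U' := [seq (w.1 * phi, phi * w.2) | w <- U]
  ++ [seq (p1 a, - y ^+ a) | a <- iota 0 D].

Let p10 m : (D <= m)%N -> p1 m = 0.
Proof. by move=> le; apply: tail_ge => //; apply: leqW. Qed.

Let local_p1 m : local n.+1 (p1 m).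
Proof.
apply: local_tail => [k|]; last exact: localX.
exact: localW (leqnSn _) (loop_local lp k).
Qed.

Let comm_p1 m r : (n <= r)%N -> GRing.comm (p1 m) (X r).
Proof. exact: comm_tailX. Qed.

Lemma pulls_same : pulls (rcons s i) U'.
Proof.
move=> w; rewrite mem_cat size_rcons => /orP[/mapP[v /pU[l1 l2 [s' [ps es]]] ->]|].
  have sz : n = (size s').+1 by rewrite -(perm_size ps) size_rcons.
  have lphi : local n.+1 phi by apply: localPsi; rewrite sz.
  split=> /=; [exact: localM (localW (leqnSn _) l1) lphi
    |exact: localM lphi (localW (leqnSn _) l2)|].
  exists (rcons s' i); split=> [|q]; first by rewrite -!cats1 perm_cat2r cats1.
  rewrite !cat_rcons -mulrA es mulrA sz /=.
  by rewrite (sys_PsiE sys) mulrA.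
move=> /mapP[b _ ->] /=; split=> //; first exact/localN/local_exp/localX.
exists s; split=> // q; rewrite cat_rcons mulNr mulrN; congr (- _).
by apply/commr_sym/commrX/commr_sym/cXE.
Qed.

Lemma wsum_same A : wsum U' A
  = wsum U (phi * A * phi) - \sum_(b < D) p1 b * A * y ^+ b.
Proof.
rewrite /wsum big_cat !big_map /=; congr (_ + _).
  by apply: eq_bigr => w _; rewrite !mulrA.
rewrite -sumrN -(big_mkord xpredT (fun b => - (p1 b * A * y ^+ b))) /index_iota subn0.
by apply: eq_bigr => b _; rewrite mulrN.
Qed.

(** Conjugating [loop_zero] by [psi] pulls the strand past the new one; the braid relation has no
    error term because [Q i i = 0]. *)
Lemma zero_same q :
  (wsum U' (Psi n) + tail p' D (X n.+1) 0) * E (s ++ i :: i :: q) = 0.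
Proof.
set e := E _; set psi := Psi n; set z := X n.+1.
have [cp e2 er el] := same_colour_rels q (erefl n); have [Qii _ _ _] := hQ.
have := congr1 (fun u => psi * u * psi) (loop_zero lp (i :: q)).
rewrite mulr0 mul0r -!mulrA -cp !mulrA -/psi.
rewrite mulrDr !mulrDl => H; rewrite wsum_same mulrBl.
have -> : wsum U (phi * psi * phi) * e = psi * wsum U phi * psi * e.
  have c1 : {in U, forall w, GRing.comm w.1 psi}.
    by move=> w /pU[l1 _ _]; case: (l1 _ (leqnn n)).
  have c2 : {in U, forall w, GRing.comm w.2 psi}.
    by move=> w /pU[_ l2 _]; case: (l2 _ (leqnn n)).
  rewrite -(wsumMl _ c1) -(wsumMr _ c2).
  apply: wsum_sandwich => // s' sz; have := sys_braid sys s' i i q.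
  by rewrite Qii size_poly0 big_ord0 addr0 /psi sz.
rewrite -/e in H; move: H => /eqP; rewrite addr_eq0 => /eqP ->.
suff -> : psi * tail p D y 0 * psi * e
    = - (\sum_(b < D) p1 b * psi * y ^+ b) * e + tail p' D z 0 * e.
  by rewrite mulNr opprD opprK [X in X + _]addrAC subrr add0r addNr.
(* Two summations by parts follow: the first yields [p1] against powers of [z]; moving these across
   [psi] gives the added pairs of [U'], and the remaining divided differences give [p']. *)
have -> : psi * tail p D y 0 * psi * e
    = - (\sum_(m < D) p m * conv y (GRing.exp z) m) * psi * e.
  rewrite /tail mulr_sumr -sumrN !mulr_suml; apply: eq_bigr => m _.
  have [_ cpsi] := loop_local lp (0 + m)%N (leqnn n).
  have H1 := psi_expr_psi (cXX _ _) (cXE _ _) cp e2 er m.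
  by rewrite mulrA -cpsi !mulNr -!mulrA; rewrite !mulNr -!mulrA in H1; rewrite H1 mulrN.
rewrite (sum_conv _ _ p0) -mulrA mulNr mulr_suml.
have -> : \sum_(b < D) tail p D y b.+1 * z ^+ b * (psi * e)
    = \sum_(b < D) p1 b * psi * y ^+ b * e
      + (\sum_(b < D) p1 b * conv y (GRing.exp z) b) * e.
  rewrite mulr_suml -big_split; apply: eq_bigr => b _ /=.
  rewrite -mulrA [z ^+ b * _]mulrA (expr_psi (cXX _ _) (cXE _ _) er).
  by rewrite mulrDl mulrDr !mulrA.
rewrite (sum_conv _ _ p10) opprD mulNr mulr_suml; congr (_ + _).
  by rewrite mulr_suml.
rewrite [tail p' _ _ _]/tail mulr_suml -sumrN; apply: eq_bigr => b _.
by rewrite add0n /p' !mulNr.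
Qed.

Lemma lead_same c q : leads (lser U p n) a c (E (s ++ i :: q)) ->
  leads (lser U' p' n.+1) (a - 2) (- c) (E (s ++ i :: q)).
Proof.
set e := E _ => ld.
(* [b1] and [b2] are the series after one and two divisions by $X-y$; the new series is [- b2]. *)
pose b1 (z : int) := match z with Posz m => p1 m | Negz k => - half k end.
pose b2 (z : int) :=
  match z with Posz m => tail p1 D y m.+1 | Negz k => - wsum U' (y ^+ k) end.
have pred0 : Posz 0 - 1 = Negz 0 by [].
have predP (m : nat) : Posz m.+1 - 1 = m by lia.
have predN (m : nat) : Negz m - 1 = Negz m.+1 by lia.
have ld1 : leads b1 (a - 1) c e.
  apply: (leads_div (y := y) (D := D)) ld => [m /p10 H|]; first by rewrite /= H mul0r.
  case=> [[|m]|k]; rewrite ?(pred0, predP, predN) /=.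
  - rewrite mulNr half0 mulNr opprK (tailS _ 0 p0) mulrDl addrC mulrA.
    by rewrite -(comm_p1 0 (leqnn _)).
  - by rewrite [p1 m](tailS _ m.+1 p0) mulrDl addrC mulrA (comm_p1 _ (leqnn _)).
  - by rewrite mulNr halfS' opprB mulNr mulrN addrC.
have cT k : GRing.comm (tail p1 D y k) y.
  by apply: comm_tail => // m; apply: comm_p1.
have wk k : wsum U' (y ^+ k) = full k - tail p1 D y 0 * y ^+ k.
  rewrite wsum_same; congr (_ - _); rewrite /tail mulr_suml; apply: eq_bigr => b _.
  by rewrite add0n -!mulrA -!exprD addnC.
have ld2 : leads b2 (a - 1 - 1) c e.
  apply: (leads_div (y := y) (D := D)) ld1 => [m le|].
    by rewrite /= (tail_ge _ p10) ?mul0r // leqW.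
  case=> [[|m]|k]; rewrite ?(pred0, predP, predN) /=.
  - by rewrite wk mulr1 opprB mulrBl full0 subr0 (tailS _ 0 p10) mulrDl addrC cT mulrA.
  - by rewrite (tailS _ m.+1 p10) mulrDl addrC cT mulrA.
  - rewrite !wk !opprB !mulrBl fullS exprS mulrA cT mulrBr !mulNr !mulrA.
    by rewrite opprD addrA.
have -> : a - 2 = a - 1 - 1 by lia.
apply: leads_ext (leadsN ld2) => -[m|k] //=; exact: opprK.
Qed.

Lemma loop_same : exists U' p' D', loop (rcons s i) (a - 2) U' p' D'.
Proof.
exists U', p', D; split.
- exact: pulls_same.
- move=> m; rewrite size_rcons; apply/localN/local_tail => //; exact: localX.
- by move=> m le; rewrite /p' (tail_ge _ p10) ?oppr0 // leqW.
- by move=> q; rewrite size_rcons cat_rcons zero_same.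
case: (loop_lead lp) => c c0 ld; exists (- c); first by rewrite oppr_eq0.
by move=> q; rewrite size_rcons cat_rcons; apply: lead_same.
Qed.

End SameColourStep.

(** By homogeneity, a nonzero coefficient of $u^mv^q$ forces $d_im+d_jq=d_id$, hence $m\le d$, with
    equality only for $q=0$. *)
Lemma klr_coef j : i != j ->
  let d := `|- cartan i j|%N in
  [/\ - cartan i j = d%:Z, forall m, (d < m)%N -> (Q i j)`_m = 0 &
      exists2 c, c != 0 & (Q i j)`_d = c%:P].
Proof.
move=> ij d; have [_ Qh Qd _] := hQ.
have cii k : @cartan l k k = 2 by rewrite /cartan eqxx.
have cij : cartan i j <= 0.
  by rewrite /cartan (negbTE ij); case: ifP => // _; case: ifP.
have symd_gt0 k : 0 < @symd l k by rewrite /symd; case: ifP.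
have dE : - cartan i j = d%:Z by rewrite /d; lia.
have Qh' m q : (Q i j)`_m`_q != 0 ->
    2 * symd i * (m%:Z - d%:Z) + 2 * symd j * q%:Z = 0.
  by move=> /(Qh _ _ _ _ ij); rewrite /form_simple !cii -dE => H; rewrite -[RHS]H; ring.
split=> // [m lt|].
  apply/polyP => q; rewrite coef0; apply/eqP/negPn/negP => /Qh' H.
  have := symd_gt0 i; have := symd_gt0 j; nia.
exists (Q i j)`_d`_0; first exact: Qd.
apply/polyP => q; rewrite coefC; case: eqP => [->//|/eqP q0].
by apply/eqP/negPn/negP => /Qh' H; have := symd_gt0 j; nia.
Qed.

(** * A new strand of another colour: multiplication of the series by $Q_{ij}(X,y)$ *)

Section OtherColourStep.
Variables (j : I) (ij : i != j).
Variables (s : seq I) (a : int) (U : seq (R * R)) (p : nat -> R) (D : nat).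
Hypothesis lp : loop s a U p D.
Local Notation n := (size s).
Local Notation x := (X n.-1).
Local Notation phi := (Psi n.-1).
Local Notation y := (X n).

Let pU := loop_pulls lp.
Let p0 := loop_bound lp.
(** [qc m] is the coefficient of $X^m$ in $Q_{ij}(X,y)$. The product moves some negative terms of
    the old series into [p'], whence [lser] at possibly negative arguments. *)
Let qc m := ev sc (Q i j)`_m y.
Let dQ := size (Q i j).
Let p' (k : nat) := \sum_(m < dQ) qc m * lser U p n (k%:Z - m%:Z).
Let U' := [seq (w.1 * phi, phi * w.2) | w <- U].

Let local_lser z : local n.+1 (lser U p n z).
Proof.
case: z => [m|k] /=; first exact: localW (leqnSn _) (loop_local lp m).
apply: local_wsum pU _ _ => //; apply/local_exp/localX; lia.
Qed.

Lemma pulls_other : pulls (rcons s j) U'.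
Proof.
move=> w /mapP[v vU ->]; have [l1 l2 [s' [ps es]]] := pU vU.
have sz : n = (size s').+1 by rewrite -(perm_size ps) size_rcons.
have lphi : local n.+1 phi by apply: localPsi; rewrite sz.
rewrite size_rcons; split=> /=; [exact: localM (localW (leqnSn _) l1) lphi
  |exact: localM lphi (localW (leqnSn _) l2)|].
exists (rcons s' j); split=> [|q].
  apply/seq.permP => P; have /seq.permP/(_ P) := ps.
  by rewrite -!cats1 !count_cat /= => <-; lia.
rewrite !cat_rcons -mulrA es mulrA sz /=.
by rewrite (sys_PsiE sys) mulrA.
Qed.

Lemma wsum_other A : wsum U' A = wsum U (phi * A * phi).
Proof.
by rewrite /wsum big_map; apply: eq_bigr => w _; rewrite /= !mulrA.
Qed.

Let wsum_qc m A : wsum U (qc m * A) = qc m * wsum U A.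
Proof.
apply: wsumMl => w wU; apply: comm_ev; exact: (pulls_commX1 pU (leqnn _) wU).
Qed.

(** The polynomial part of $X^m$ times the series, at [z]: exactly [m] bubbles move up to
    nonnegative degree. The bound [D + dQ] serves all [m] at once. *)
Lemma shift_lser m z : (m < dQ)%N ->
  \sum_(b < m) wsum U (x ^+ (m.-1 - b)) * z ^+ b
    + \sum_(b < D) p b * z ^+ (m + b)
  = \sum_(k < D + dQ) lser U p n (k%:Z - m%:Z) * z ^+ k.
Proof.
move=> lt; pose f k := lser U p n (k%:Z - m%:Z) * z ^+ k.
rewrite -(big_mkord xpredT f) (@big_cat_nat _ _ _ m) //=; last lia.
rewrite (@big_cat_nat _ _ _ (m + D) m) //=; [|lia|lia].
rewrite [X in _ + (_ + X)]big_nat [X in _ + (_ + X)]big1 ?addr0; last first.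
  move=> k /andP[le _]; rewrite /f (_ : _ - _ = Posz (k - m)); last lia.
  by rewrite /= p0 ?mul0r //; lia.
congr (_ + _).
  rewrite big_mkord; apply: eq_bigr => b _; rewrite /f.
  by rewrite (_ : _ - _ = Negz (m.-1 - b)) //; case: b => b /=; lia.
rewrite -[X in \sum_(X <= _ < _) _]add0n big_addn addKn big_mkord.
apply: eq_bigr => b _; rewrite /f.
rewrite (_ : _ - _ = Posz b) /=; last lia.
by rewrite addnC.
Qed.

(** Conjugation by [psi] again: the error term of the braid relation contributes the bubbles that
    move into [p'], and [psi * y ^+ m * psi] contributes $Q_{ij}(z,y)z^m$. *)
Lemma zero_other q : (wsum U' (Psi n) + tail p' (D + dQ) (X n.+1) 0)
  * E (s ++ j :: i :: q) = 0.
Proof.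
set e := E _; set psi := Psi n; set z := X n.+1; have [_ _ _ Qs] := hQ.
have ePsi : psi * e = E (s ++ i :: j :: q) * psi by exact: (sys_PsiE sys).
have := congr1 (fun u => psi * u * psi) (loop_zero lp (j :: q)).
rewrite mulr0 mul0r -!mulrA -ePsi !mulrA -/psi mulrDr !mulrDl.
move=> /eqP; rewrite addr_eq0 => /eqP H.
have wE : wsum U (phi * psi * phi) * e = psi * wsum U phi * psi * e
    - \sum_(m < dQ) qc m * wsum U (conv x (GRing.exp z) m) * e.
  have c1 : {in U, forall w, GRing.comm w.1 psi}.
    by move=> w /pU[l1 _ _]; case: (l1 _ (leqnn n)).
  have c2 : {in U, forall w, GRing.comm w.2 psi}.
    by move=> w /pU[_ l2 _]; case: (l2 _ (leqnn n)).
  rewrite -(wsumMl _ c1) -(wsumMr _ c2).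
  have -> : \sum_(m < dQ) qc m * wsum U (conv x (GRing.exp z) m) * e
      = wsum U (\sum_(m < dQ) qc m * conv x (GRing.exp z) m) * e.
    by rewrite wsum_sum mulr_suml; apply: eq_bigr => m _; rewrite wsum_qc.
  rewrite -mulrBl -wsumN -wsumD; apply: wsum_sandwich => // s' sz.
  have := sys_braid sys s' i j q; rewrite /psi /qc /z sz /= => B.
  by rewrite mulrBl B -mulrBl addrK.
have yE m : psi * y ^+ m * psi * e = ev2 sc (Q i j) z y * z ^+ m * e.
  apply: psi_expr_psi_slide; first exact: cXE.
    by have := sys_XPsi_l sys s j i q; rewrite eq_sym (negbTE ij) subr0.
  by rewrite (sys_Psi2 sys) Qs (ev2_swapXY _ _ (cXX _ _)).
have tE : psi * tail p D y 0 * psi * e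
    = \sum_(m < dQ) qc m * (\sum_(b < D) p b * z ^+ (m + b)) * e.
  rewrite /tail mulr_sumr !mulr_suml.
  have step (b : 'I_D) : psi * (p (0 + b)%N * y ^+ b) * psi * e
      = \sum_(m < dQ) qc m * (p b * z ^+ (m + b)) * e.
    have [_ cpsi] := loop_local lp (0 + b)%N (leqnn n).
    have yE' : psi * (y ^+ b * (psi * e)) = ev2 sc (Q i j) z y * (z ^+ b * e).
      by rewrite !mulrA yE.
    rewrite mulrA -cpsi -!mulrA yE' add0n /ev2 mulr_suml mulr_sumr.
    have cp m : GRing.comm (p b) (qc m).
      by apply: comm_ev; have [] := loop_local lp b (leqnn n).
    apply: eq_bigr => m _; rewrite -/(qc m) exprD !mulrA; congr (_ * _ * _ * _).
    exact: cp.
  under eq_bigr => b _ do rewrite step.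
  rewrite exchange_big; apply: eq_bigr => m _ /=.
  by rewrite mulr_sumr mulr_suml.
rewrite wsum_other wE H tE -opprD -big_split /=.
apply/eqP; rewrite addrC subr_eq0; apply/eqP.
rewrite /tail mulr_suml.
have -> : \sum_(k < D + dQ) p' (0 + k)%N * z ^+ k * e
    = \sum_(m < dQ) qc m * (\sum_(k < D + dQ) lser U p n (k%:Z - m%:Z) * z ^+ k) * e.
  under eq_bigr => k _ do rewrite add0n /p' !mulr_suml.
  rewrite exchange_big; apply: eq_bigr => m _ /=.
  by rewrite mulr_sumr mulr_suml; apply: eq_bigr => k _; rewrite !mulrA.
apply: eq_bigr => m _; rewrite -mulrDl -mulrDr -shift_lser // addrC.
congr (_ * (_ + _) * _); rewrite /conv wsum_sum; apply: eq_bigr => b _.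
rewrite wsumMr // => w wU; apply/commrX.
exact: (pulls_commX2 pU (leqnSn _) wU).
Qed.

(** In negative degree, each bubble crosses the new strand twice, and this double crossing equals
    $Q_{ij}(x,y)$. *)
Lemma lser_other z q : lser U' p' n.+1 z * E (s ++ j :: q)
  = \sum_(m < dQ) qc m * (lser U p n (z - m%:Z) * E (s ++ j :: q)).
Proof.
case: z => [k|k] /=.
  by rewrite /p' mulr_suml; apply: eq_bigr => m _; rewrite mulrA.
rewrite wsum_other.
have -> : wsum U (phi * y ^+ k * phi) * E (s ++ j :: q)
    = wsum U (\sum_(m < dQ) qc m * x ^+ (k + m)) * E (s ++ j :: q).
  apply: wsum_sandwich => // s' sz; rewrite /qc sz /=.
  set e := E _; set z := X (size s').+1; set u := X (size s').
  set psi := Psi (size s').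
  rewrite (psi_expr_psi_slide (z := u) (t := ev2 sc (Q i j) u z)); last first.
  - exact: (sys_Psi2 sys).
  - by have := sys_XPsi_r sys s' i j q; rewrite (negbTE ij) addr0.
  - exact: cXE.
  congr (_ * _).
  rewrite /ev2 mulr_suml; apply: eq_bigr => m _.
  by rewrite -mulrA -exprD addnC.
rewrite wsum_sum mulr_suml; apply: eq_bigr => m _.
rewrite wsum_qc -mulrA; congr (_ * (_ * _)).
by rewrite (_ : Negz k - m%:Z = Negz (k + m)) //; lia.
Qed.

Lemma loop_other : exists U' p' D', loop (rcons s j) (a - cartan i j) U' p' D'.
Proof.
exists U', p', (D + dQ)%N; split.
- exact: pulls_other.
- move=> m; rewrite size_rcons /p'; apply: local_sum => b _; apply: localM => //.
  exact/local_ev/localX.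
- move=> m le; rewrite /p' big1 // => b _.
  by rewrite (_ : _ - _ = Posz (m - b)) /= ?p0 ?mulr0 //; case: b => b /=; lia.
- by move=> q; rewrite size_rcons cat_rcons zero_other.
have [dE Q0 [cd cd0 Qd]] := klr_coef ij; set d := `|_|%N in dE Q0 Qd.
(* The leading coefficients multiply: that of $Q_{ij}(X,y)$ is the constant [cd], in degree
   $-a_{ij}$. *)
case: (loop_lead lp) => c c0 ld; exists (cd * c); first by rewrite mulf_neq0.
move=> q; rewrite size_rcons cat_rcons; have [la lz] := ld (j :: q).
have dlt : (d < dQ)%N.
  by rewrite ltnNge; apply/negP => /(nth_default 0); rewrite Qd => /eqP;
    rewrite polyC_eq0 (negbTE cd0).
have qc0 m : (d < m)%N -> qc m = 0 by move=> /Q0 H; rewrite /qc H ev0.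
rewrite dE; split=> [|z lt]; rewrite lser_other; last first.
  rewrite big1 // => m _; case: (ltnP d m) => [/qc0->|le]; first by rewrite mul0r.
  by rewrite lz ?mulr0 //; lia.
rewrite (bigD1 (Ordinal dlt)) //= addrK la big1 ?addr0.
  by rewrite /qc Qd evC rmorphM mulrA.
move=> m; rewrite -val_eqE /= => neq.
case: (ltnP d m) => [/qc0->|le]; first by rewrite mul0r.
by rewrite lz ?mulr0 //; lia.
Qed.

End OtherColourStep.

Lemma loop_exists s : exists U p D,
  loop s ((L i)%:Z - \sum_(j <- s) cartan i j) U p D.
Proof.
elim/last_ind: s => [|s j [U [p [D lp]]]].
  by rewrite big_nil subr0; exact: loop_nil.
rewrite -cats1 big_cat big_seq1 /= opprD addrA cats1.
have [<-|ij] := eqVneq i j; last exact: loop_other ij _ _ _ _ _ lp.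
by have := loop_same lp; rewrite /cartan eqxx.
Qed.

End FixedColour.
End Loop.

(** * Bound on the number of consecutive strands of one colour *)

Section Strings.
Variables (F : fieldType) (l : nat).
Local Notation I := 'I_l.+1.
Variables (Q : I -> I -> {poly {poly F}}) (L : dom_weight l).
Hypothesis hQ : klr_datum Q.
Variables (R : pzRingType) (sc : {rmorphism F -> R}) (X Psi : nat -> R)
  (E : seq I -> R).
Hypothesis sys : klr_system Q L sc X Psi E.

Let cXX := sys_XX sys.
Let cXE := sys_XE sys.

Lemma sc_eq0 c e : c != 0 -> sc c * e = 0 -> e = 0.
Proof.
move=> c0 ce; rewrite -[e]mul1r -(rmorph1 sc) -(mulVf c0) rmorphM.
by rewrite -mulrA ce mulr0.
Qed.

Lemma tail_mul_eq0 p D y (e : R) m : GRing.comm y e ->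
  (forall k, (m < k)%N -> p k * e = 0) ->
  forall k, (m < k)%N -> tail p D y k * e = 0.
Proof.
move=> cye pk k lt; rewrite /tail mulr_suml big1 // => b _.
rewrite -mulrA -(commrX b (commr_sym cye)) mulrA pk ?mul0r //.
exact: leq_trans lt (leq_addr _ _).
Qed.

(* The divided difference of a relation satisfied by the first of the strands
   coloured [i] is satisfied by the second one, with degree one less. *)
Lemma nilHecke_eq0 i m s q p D c : let e := E (s ++ nseq m.+1 i ++ q) in
    (forall k, local X Psi (size s) (p k)) ->
    (forall k, (D <= k)%N -> p k = 0) ->
    c != 0 -> p m * e = sc c * e ->
    (forall k, (m < k)%N -> p k * e = 0) ->
    tail p D (X (size s)) 0 * e = 0 ->
  e = 0.
Proof.
elim: m s p => [|m IH] s p e lp p0 c0 pm pk te;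
  have cye : GRing.comm (X (size s)) e by exact: cXE.
  apply: (sc_eq0 c0); rewrite -pm -te (tailS _ 0 p0) mulrDl -mulrA.
  by rewrite cye mulrA (tail_mul_eq0 _ cye pk) ?mul0r ?addr0.
set n := size s in lp te cye; pose y := X n; pose z := X n.+1; pose psi := Psi n.
have [cp e2 er el] := same_colour_rels hQ sys i (nseq m i ++ q) (erefl n).
rewrite -/y -/z -/psi -[E _]/e -/y in cp e2 er el te cye.
pose p1 k := tail p D y k.+1.
have p10 k : (D <= k)%N -> p1 k = 0 by move=> le; apply: tail_ge => //; apply: leqW.
have lp1 k : local X Psi n.+1 (p1 k).
  apply: local_tail => [b|]; last exact: (localX sys).
  exact: localW (leqnSn _) (lp b).
(* Conjugation by [psi] turns $p(y)$ into its divided difference at [y], [z], up to sign, followed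
   by [psi]. *)
have gpsi : tail p1 D z 0 * psi * e = 0.
  have : psi * tail p D y 0 * psi * e = 0.
    by rewrite -mulrA cp mulrA -[_ * e]mulrA te mulr0 mul0r.
  suff -> : psi * tail p D y 0 * psi * e = - (tail p1 D z 0 * psi * e).
    by move/eqP; rewrite oppr_eq0 => /eqP.
  have -> : tail p1 D z 0 = \sum_(b < D) p b * conv y (GRing.exp z) b.
    by rewrite (sum_conv _ _ p0).
  rewrite /tail mulr_sumr !mulr_suml -sumrN; apply: eq_bigr => b _.
  have [_ cpsi] := lp (0 + b)%N n (leqnn n).
  have H := psi_expr_psi (cXX _ _) (cXE _ _) cp e2 er b.
  rewrite mulrA -cpsi -!mulrA; rewrite !mulNr -!mulrA in H.
  by rewrite H mulrN.
have lg : GRing.comm (tail p1 D z 0) z.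
  by apply: comm_tail => // k; have [] := lp1 k n.+1 (leqnn _).
have eE : e = E (rcons s i ++ nseq m.+1 i ++ q) by rewrite cat_rcons.
rewrite eE; apply: (IH _ p1) => //; rewrite -?eE ?size_rcons //.
- rewrite /p1 (tailS _ m.+1 p0) mulrDl pm -mulrA cye mulrA.
  by rewrite (tail_mul_eq0 _ cye pk) ?mul0r ?addr0.
- by move=> k lt; apply: (tail_mul_eq0 _ cye pk).
(* The identity [e = z * psi * e - psi * y * e] removes the trailing [psi]. *)
have -> : tail p1 D z 0 * e = tail p1 D z 0 * (z * psi * e)
    - tail p1 D z 0 * (psi * y * e).
  by rewrite er -mulrBr mulrDl mul1r addrAC subrr add0r.
rewrite -[psi * y * e]mulrA [y * e]cye !mulrA gpsi mul0r subr0.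
by rewrite lg -2!mulrA [tail _ _ _ _ * _]mulrA gpsi mulr0.
Qed.

(** The maximality hypothesis kills every bubble on [e], which leaves [p] alone to carry the leading
    coefficient and to annihilate the first strand of the string. *)
Lemma string_bound i s r q : E (s ++ nseq r i ++ q) <> 0 ->
    (forall s', perm_eq (rcons s' i) s ->
      E (s' ++ i :: nseq r i ++ q) = 0) ->
  r%:Z <= (L i)%:Z - \sum_(j <- s) cartan i j.
Proof.
set e := E _ => e0 smax; rewrite leNgt; apply/negP => lt; apply: e0.
have [U [p [D lp]]] := loop_exists hQ sys i s; move: lt lp.
set a := _ - _ => lt lp; have [c c0 ld] := loop_lead lp.
have [la lz] := ld (nseq r i ++ q); rewrite -/e in la lz.
have we A : wsum U A * e = 0.
  rewrite /wsum mulr_suml; apply: big1_seq => w /andP[_].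
  move=> /(loop_pulls lp)[_ _ [s' [ps es]]].
  by rewrite -mulrA es smax // mul0r mulr0.
(* In degree [m >= 0], already [m.+1] of the [r] strands force [e = 0]; in negative degree the
   leading coefficient is itself a bubble. *)
move: lt la lz; rewrite /a; case: {lp ld}(_ - _) (lp) => [m|k] lp' lt /= la lz.
  have re : r = (m.+1 + (r - m.+1))%N by lia.
  have zero := loop_zero lp' (nseq r.-1 i ++ q).
  have er : E (s ++ i :: nseq r.-1 i ++ q) = e.
    by rewrite /e -[in RHS](prednK (_ : 0 < r)%N) //; lia.
  have ee : e = E (s ++ nseq m.+1 i ++ nseq (r - m.+1) i ++ q).
    by rewrite /e {1}re nseqD -catA.
  rewrite ee; apply: (nilHecke_eq0 (p := p) (D := D) _ _ c0); rewrite -?ee //.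
  - exact: loop_local lp'.
  - exact: loop_bound lp'.
  - by move=> k' lt'; apply: (lz (Posz k')).
  by have := zero; rewrite er mulrDl we add0r.
by apply: (sc_eq0 c0); rewrite -la we.
Qed.

End Strings.

(** * The defect and its change along a simple root *)

Section Defect.
Variables (l : nat) (hl : (2 <= l)%N) (L : dom_weight l).
Local Notation I := 'I_l.+1.
Implicit Types (b : rootQ l) (i j : I) (s : seq I).

(* The pairing of the coroot [i] with [L - b]. *)
Definition wt_pairing b i : int := (L i)%:Z - \sum_j cartan i j * (b j)%:Z.

Lemma symd_gt0 i : 0 < symd i.
Proof. by rewrite /symd; case: ifP. Qed.

Lemma form_simpleC i j : form_simple i j = form_simple j i.
Proof.
rewrite /form_simple /symd /cartan -!val_eqE /=.
case: i j => [i lti] [j ltj] /=; rewrite [j == i]eq_sym.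
by case: eqP => [->//|]; repeat case: eqP => //=; lia.
Qed.

(** This is $\frac12(\beta,\Lambda+(\Lambda-\beta))$, expanded by $(\alpha_i,\mu)=d_i\langle
    h_i,\mu\rangle$. *)
Lemma defectE b : defect L b
  = 2^-1 * (\sum_i symd i * (b i)%:Z * ((L i)%:Z + wt_pairing b i))%:Q.
Proof.
have -> : \sum_i symd i * (b i)%:Z * ((L i)%:Z + wt_pairing b i)
    = 2 * form_weight_root L b - form_root b b.
  rewrite /form_weight_root /form_root mulr_sumr -sumrB; apply: eq_bigr => i _.
  have -> : \sum_j (b i)%:Z * (b j)%:Z * form_simple i j
      = symd i * (b i)%:Z * \sum_j cartan i j * (b j)%:Z.
    by rewrite mulr_sumr; apply: eq_bigr => j _; rewrite /form_simple; ring.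
  by rewrite /wt_pairing; ring.
by rewrite /defect rmorphB rmorphM /= mulrBr mulrA mulVf // mul1r.
Qed.

Lemma defect_ge0 b : (forall i, 0 <= wt_pairing b i) -> 0 <= defect L b.
Proof.
move=> dom; rewrite defectE mulr_ge0 ?invr_ge0 // ler0z sumr_ge0 // => i _.
apply: mulr_ge0; [apply: mulr_ge0|apply: addr_ge0] => //; exact/ltW/symd_gt0.
Qed.

Lemma form_root_simple b i :
  \sum_j \sum_k (b j)%:Z * (simple_root i k)%:Z * form_simple j k
  = symd i * \sum_j cartan i j * (b j)%:Z.
Proof.
rewrite mulr_sumr; apply: eq_bigr => j _; rewrite (bigD1 i) //= big1 => [|k neq].
  by rewrite ffunE eqxx form_simpleC /form_simple /=; ring.
by rewrite ffunE (negbTE neq) mulr0 mul0r.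
Qed.

Lemma rootQDE b (i : I) r j :
  ((b + simple_root i *+ r)%R j)%:Z = (b j)%:Z + r%:Z * (simple_root i j)%:Z.
Proof.
have mE k : (simple_root i *+ k) j = (k * simple_root i j)%N.
  elim: k => [|k IH]; first by rewrite mulr0n ffunE.
  by rewrite mulrS ffunE IH mulSn.
by rewrite ffunE mE PoszD PoszM.
Qed.

Lemma wt_pairingD b i r :
  wt_pairing (b + simple_root i *+ r) i = wt_pairing b i - 2 * r%:Z.
Proof.
rewrite /wt_pairing -addrA -opprD; congr (_ - _).
under eq_bigr => j _ do rewrite rootQDE mulrDr.
rewrite big_split /=; congr (_ + _); rewrite (bigD1 i) //= big1 => [|k neq].
  by rewrite ffunE eqxx /cartan eqxx /=; ring.
by rewrite ffunE (negbTE neq) /=; ring.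
Qed.

(** The quadratic term comes from $(\alpha_i,\alpha_i)=2d_i$. The change is nonnegative as soon as
    [r] is at most the pairing, which is what [string_bound] provides. *)
Lemma defectD b i r : defect L (b + simple_root i *+ r)
  = defect L b + (symd i * r%:Z * (wt_pairing b i - r%:Z))%:Q.
Proof.
have wr : form_weight_root L (b + simple_root i *+ r)
    = form_weight_root L b + r%:Z * (L i)%:Z * symd i.
  rewrite /form_weight_root.
  have -> : r%:Z * (L i)%:Z * symd i
      = \sum_j (L j)%:Z * (r%:Z * (simple_root i j)%:Z) * symd j.
    rewrite (bigD1 i) //= big1 => [|k neq]; first by rewrite ffunE eqxx /=; ring.
    by rewrite ffunE (negbTE neq) /=; ring.
  by rewrite -big_split; apply: eq_bigr => j _; rewrite rootQDE /=; ring.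
have rr : form_root (b + simple_root i *+ r) (b + simple_root i *+ r)
    = form_root b b + 2 * r%:Z * (symd i * \sum_j cartan i j * (b j)%:Z)
      + 2 * r%:Z * r%:Z * symd i.
  have ss : symd i * \sum_j cartan i j * (simple_root i j)%:Z = 2 * symd i.
    rewrite (bigD1 i) //= big1 => [|k neq].
      by rewrite ffunE eqxx /cartan eqxx /=; ring.
    by rewrite ffunE (negbTE neq) mulr0.
  have -> : 2 * r%:Z * r%:Z * symd i = r%:Z * r%:Z * (2 * symd i) by ring.
  rewrite -ss -!form_root_simple /form_root !mulr_sumr -!big_split /=.
  have C : \sum_j \sum_k (b j)%:Z * (simple_root i k)%:Z * form_simple j k
      = \sum_j \sum_k (simple_root i j)%:Z * (b k)%:Z * form_simple j k.
    rewrite exchange_big; apply: eq_bigr => j _; apply: eq_bigr => k _ /=.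
    by rewrite form_simpleC; ring.
  transitivity (\sum_j (\sum_k (b j)%:Z * (b k)%:Z * form_simple j k
     + r%:Z * \sum_k (b j)%:Z * (simple_root i k)%:Z * form_simple j k
     + r%:Z * \sum_k (simple_root i j)%:Z * (b k)%:Z * form_simple j k
     + r%:Z * r%:Z
       * \sum_k (simple_root i j)%:Z * (simple_root i k)%:Z * form_simple j k)).
    apply: eq_bigr => j _; rewrite !mulr_sumr -!big_split; apply: eq_bigr => k _ /=.
    by rewrite !rootQDE; ring.
  rewrite !big_split /= -!mulr_sumr -C; ring.
rewrite /defect wr rr /wt_pairing.
set S := \sum_j _; rewrite !(rmorphD, rmorphB, rmorphM) /=; by field.
Qed.

Definition root_sum s : rootQ l := \sum_(j <- s) simple_root j.

Lemma root_sumE s i : root_sum s i = count_mem i s.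
Proof.
rewrite /root_sum; elim: s => [|j s IH]; first by rewrite big_nil ffunE.
by rewrite big_cons ffunE IH ffunE /= eq_sym.
Qed.

(** Identifies the degree of the loop series with the pairing. *)
Lemma wt_pairing_root_sum s i :
  wt_pairing (root_sum s) i = (L i)%:Z - \sum_(j <- s) cartan i j.
Proof.
rewrite /wt_pairing; congr (_ - _); elim: s => [|j s IH].
  by rewrite big_nil big1 // => k _; rewrite root_sumE mulr0.
rewrite big_cons -IH; under eq_bigr => k _ do rewrite root_sumE /= PoszD mulrDr.
rewrite big_split /=; congr (_ + _); last by under eq_bigr do rewrite -root_sumE.
rewrite (bigD1 j) //= eqxx mulr1 big1 ?addr0 // => k neq.
by rewrite eq_sym (negbTE neq) mulr0.
Qed.

Lemma root_sum_perm_nseq s s' i r : perm_eq (s' ++ nseq r i) s ->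
  root_sum s = root_sum s' + simple_root i *+ r.
Proof.
move=> /seq.permP ps; apply/ffunP => j; apply/eqP; rewrite -eqz_nat; apply/eqP.
rewrite rootQDE !root_sumE -ps count_cat count_nseq ffunE /= PoszD.
by rewrite eq_sym mulrC -PoszM.
Qed.

End Defect.

(** * Descent on prefixes *)

Section Main.
Variables (F : fieldType) (l : nat) (hl : (2 <= l)%N).
Local Notation I := 'I_l.+1.
Variables (Q : I -> I -> {poly {poly F}}) (L : dom_weight l).
Hypothesis hQ : klr_datum Q.
Variables (R : pzRingType) (sc : {rmorphism F -> R}) (X Psi : nat -> R)
  (E : seq I -> R).
Hypothesis sys : klr_system Q L sc X Psi E.

(** Induction on the length of [s]; the suffix is arbitrary because the strands removed from the
    prefix join it. *)
Lemma defect_prefix_ge0 s q : E (s ++ q) <> 0 -> 0 <= defect L (root_sum s).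
Proof.
elim: {s}(size s).+1 {-2}s (ltnSn (size s)) q => // n IH s szs q Es.
case: (pselect (forall i, 0 <= wt_pairing L (root_sum s) i)) => [|/existsNP[i ni]].
  exact: defect_ge0.
(* Maximality of [r] over all rearrangements of [s] supplies the vanishing hypothesis of
   [string_bound]. *)
pose P r := `[< exists s', perm_eq (s' ++ nseq r i) s
  /\ E (s' ++ nseq r i ++ q) <> 0 >].
have P0 : exists r, P r.
  by exists 0%N; apply/asboolP; exists s; rewrite cats0.
have Pmax r : P r -> (r <= size s)%N.
  move=> /asboolP[s' [ps _]]; rewrite -(perm_size ps) size_cat size_nseq.
  exact: leq_addl.
have [r /asboolP[s' [ps Es']] rmax] := ex_maxnP P0 Pmax.
have le : r%:Z <= wt_pairing L (root_sum s') i.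
  rewrite wt_pairing_root_sum; apply: (string_bound hQ sys Es') => t pt.
  apply: contrapT => Et; suff /rmax : P r.+1 by rewrite ltnn.
  apply/asboolP; exists t; split=> //; apply: perm_trans ps.
  by rewrite -cat_rcons perm_cat2r.
have rE := root_sum_perm_nseq ps.
(* For [r = 0] the pairing would be the same for [s'] as for [s], hence both negative and at least
   0. *)
have r_gt0 : (0 < r)%N.
  by move: ni; rewrite rE wt_pairingD; case: (r) le => // le; lia.
have szs' : (size s' < n)%N.
  have := perm_size ps; rewrite size_cat size_nseq => sz.
  by rewrite -ltnS; apply: leq_trans szs; rewrite ltnS -sz -addn1 leq_add2l.
rewrite rE defectD // addr_ge0 ?(IH _ szs' _ Es') //.
by rewrite ler0z; have := symd_gt0 i; nia.
Qed.

End Main.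

(** * From relations indexed by ordinals and tuples to a [klr_system] *)

Section MorphEval.
Variables (F : fieldType) (A : algType F) (R : pzRingType)
  (sc : {rmorphism F -> R}) (f : {rmorphism A -> R}).
Hypothesis fZ : forall c u, f (c *: u) = sc c * f u.

Lemma rmorph_eval2 P a b : GRing.comm (f a) (f b) ->
  f (eval2 P a b) = ev2 sc P (f a) (f b).
Proof.
move=> cab; rewrite /eval2 /ev2 rmorph_sum; apply: eq_bigr => m _ /=.
rewrite rmorph_sum /ev mulr_suml; apply: eq_bigr => q _ /=.
rewrite fZ rmorphM !rmorphXn -mulrA; congr (_ * _).
exact/commrX/commr_sym/commrX/commr_sym.
Qed.

Lemma rmorph_divdiff2 P a b c :
    GRing.comm (f a) (f b) -> GRing.comm (f b) (f c) ->
  f (divdiff2 P a b c) = \sum_(m < size P) ev sc P`_m (f b)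
    * conv (f a) (GRing.exp (f c)) m.
Proof.
move=> cab cbc; rewrite /divdiff2 rmorph_sum; apply: eq_bigr => m _ /=.
rewrite rmorph_sum /ev mulr_suml; apply: eq_bigr => q _ /=.
rewrite fZ rmorphM rmorphXn rmorph_sum -mulrA; congr (_ * _).
have -> : \sum_(s < m) f (a ^+ (m.-1 - s) * c ^+ s)
    = conv (f a) (GRing.exp (f c)) m.
  by apply: eq_bigr => s _; rewrite rmorphM !rmorphXn.
apply: commr_sym; rewrite /conv.
elim/big_ind: _ => [|u v|s _]; [exact: commr0|exact: commrD|].
apply: commrM; last exact/commrX/commr_sym/commrX/commr_sym.
exact/commrX/commr_sym/commrX.
Qed.


Variables (l : nat) (Q : 'I_l.+1 -> 'I_l.+1 -> {poly {poly F}})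
  (L : dom_weight l) (N : nat).
Local Notation I := 'I_l.+1.
Variables (e : N.-tuple I -> A) (x : 'I_N -> A) (psi : 'I_N.-1 -> A).
Hypotheses
  (rel_xe : forall r nu, f (x r * e nu) = f (e nu * x r))
  (rel_psie : forall k nu, f (psi k * e nu) = f (e (swap k nu) * psi k))
  (rel_xx : forall r s, f (x r * x s) = f (x s * x r))
  (rel_psix : forall k s, s != lpos k -> s != rpos k ->
    f (psi k * x s) = f (x s * psi k))
  (rel_psipsi : forall k k' : 'I_N.-1, (k.+1 < k')%N || (k'.+1 < k)%N ->
    f (psi k * psi k') = f (psi k' * psi k))
  (rel_xpsi_l : forall k nu, f (x (lpos k) * psi k * e nu)
    = f ((psi k * x (rpos k) - (tnth nu (lpos k) == tnth nu (rpos k))%:R) * e nu))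
  (rel_xpsi_r : forall k nu, f (x (rpos k) * psi k * e nu)
    = f ((psi k * x (lpos k) + (tnth nu (lpos k) == tnth nu (rpos k))%:R) * e nu))
  (rel_psi2 : forall k nu, f (psi k ^+ 2 * e nu)
    = f (eval2 (Q (tnth nu (lpos k)) (tnth nu (rpos k))) (x (lpos k)) (x (rpos k))
         * e nu))
  (rel_braid : forall (k k' : 'I_N.-1) nu, k' = k.+1 :> nat ->
    f ((psi k' * psi k * psi k' - psi k * psi k' * psi k) * e nu)
    = f (if tnth nu (lpos k) == tnth nu (rpos k') then
         divdiff2 (Q (tnth nu (lpos k)) (tnth nu (rpos k)))
           (x (lpos k)) (x (rpos k)) (x (rpos k')) * e nu
       else 0))
  (rel_cyclotomic : forall (r : 'I_N) nu, r = 0 :> nat ->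
    f (x r ^+ L (tnth nu r) * e nu) = f 0)
  (sc_comm : forall c y, GRing.comm (sc c) y).

(** Generators out of range, and idempotents of sequences of the wrong length, are 0, so that the
    relations hold there trivially. *)
Definition nat_x (r : nat) : R :=
  if (insub r : option 'I_N) is Some r' then f (x r') else 0.
Definition nat_psi (k : nat) : R :=
  if (insub k : option 'I_N.-1) is Some k' then f (psi k') else 0.
Definition seq_e (s : seq I) : R :=
  if (insub s : option (N.-tuple I)) is Some t then f (e t) else 0.

Lemma nat_xE (r : 'I_N) (m : nat) : m = r -> nat_x m = f (x r).
Proof. by move=> ->; rewrite /nat_x valK. Qed.

Lemma nat_psiE (k : 'I_N.-1) (m : nat) : m = k -> nat_psi m = f (psi k).
Proof. by move=> ->; rewrite /nat_psi valK. Qed.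

Lemma seq_eE (t : N.-tuple I) (s : seq I) : s = t -> seq_e s = f (e t).
Proof. by move=> ->; rewrite /seq_e valK. Qed.

Lemma seq_e0 s : size s != N -> seq_e s = 0.
Proof. by move=> sz; rewrite /seq_e insubF // (negbTE sz). Qed.

Lemma swap_cat p a b q (k : 'I_N.-1) (t t' : N.-tuple I) :
    size p = k -> tval t = p ++ a :: b :: q -> tval t' = p ++ b :: a :: q ->
  swap k t = t'.
Proof.
move=> sk et et'; apply: eq_from_tnth => r; rewrite tnth_mktuple.
rewrite !(tnth_nth a) et et' !nth_cat sk.
case: tpermP => [->|->|/eqP neql /eqP neqr] /=.
- by rewrite ltnNge leqnSn /= subSnn ltnn subnn.
- by rewrite ltnn subnn ltnNge leqnSn /= subSnn.
have rl : r != k :> nat by apply: contraNneq neql => rk; apply/eqP/val_inj.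
have rr : r != k.+1 :> nat by apply: contraNneq neqr => rk; apply/eqP/val_inj.
(* Here [r >= k + 2], beyond both exchanged entries. *)
case: ltnP => // le; have -> : (r - k = (r - k).-2.+2)%N by lia.
by [].
Qed.

Lemma xx_comm r s : GRing.comm (nat_x r) (nat_x s).
Proof.
rewrite /nat_x; case: insub => [r'|]; last exact/commr_sym/commr0.
case: insub => [s'|]; last exact: commr0.
by rewrite /GRing.comm -!rmorphM; apply: rel_xx.
Qed.

Lemma seq_e_cases s :
  seq_e s = 0 \/ exists2 t : N.-tuple I, tval t = s & seq_e s = f (e t).
Proof.
by rewrite /seq_e; case: insubP => [t _ et|_]; [right; exists t|left].
Qed.

Lemma klr_system_morph : klr_system Q L sc nat_x nat_psi seq_e.
Proof.
have pair p a b q (t : N.-tuple I) : tval t = p ++ a :: b :: q ->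
    exists k : 'I_N.-1, [/\ size p = k, size p = lpos k, (size p).+1 = rpos k,
      tnth t (lpos k) = a & tnth t (rpos k) = b].
  move=> et; have sz := size_tuple t; rewrite et size_cat /= in sz.
  have ltk : (size p < N.-1)%N by rewrite -sz !addnS ltnS leq_addr.
  exists (Ordinal ltk); split=> //; rewrite (tnth_nth a) et nth_cat /=.
    by rewrite ltnn subnn.
  by rewrite ltnNge leqnSn /= subSnn.
split.
- exact: sc_comm.
- exact: xx_comm.
- move=> k s ne ne'; rewrite /nat_psi /nat_x.
  case: insubP => [k' _ ek|_]; last exact/commr_sym/commr0.
  case: insubP => [s' _ es|_]; last exact: commr0.
  rewrite /GRing.comm -!rmorphM; apply: rel_psix.
    by rewrite -val_eqE /= ek es.
  by rewrite -val_eqE /= ek es.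
- move=> k k' lt; rewrite /nat_psi.
  case: insubP => [k1 _ ek|_]; last exact/commr_sym/commr0.
  case: insubP => [k2 _ ek'|_]; last exact: commr0.
  by rewrite /GRing.comm -!rmorphM; apply: rel_psipsi; rewrite ek ek' lt.
- move=> r s; have [->|[t _ ->]] := seq_e_cases s; first exact: commr0.
  rewrite /nat_x; case: insub => [r'|]; last exact/commr_sym/commr0.
  by rewrite /GRing.comm -!rmorphM; apply: rel_xe.
- move=> p a b q; have [sz|sz] := eqVneq (size (p ++ a :: b :: q)) N; last first.
    by rewrite !seq_e0 ?mulr0 ?mul0r //; rewrite !size_cat in sz *.
  have sz' : size (p ++ b :: a :: q) = N by rewrite -sz !size_cat.
  pose t := tcast sz (in_tuple _); pose t' := tcast sz' (in_tuple _).
  have et : tval t = p ++ a :: b :: q by rewrite val_tcast.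
  have et' : tval t' = p ++ b :: a :: q by rewrite val_tcast.
  have [k [ek _ _ _ _]] := pair _ _ _ _ _ et.
  rewrite (nat_psiE ek) (seq_eE (esym et)) (seq_eE (esym et')) -!rmorphM rel_psie.
  by rewrite (swap_cat ek et et').
- move=> p a b q.
  have [->|[t /pair[k [ek el er ta tb]] ->]] := seq_e_cases (p ++ a :: b :: q).
    by rewrite !mulr0.
  rewrite (nat_psiE ek) (nat_xE el) (nat_xE er) -!rmorphM rel_xpsi_l.
  by rewrite ta tb rmorphM rmorphB rmorphM rmorph_nat.
- move=> p a b q.
  have [->|[t /pair[k [ek el er ta tb]] ->]] := seq_e_cases (p ++ a :: b :: q).
    by rewrite !mulr0.
  rewrite (nat_psiE ek) (nat_xE el) (nat_xE er) -!rmorphM rel_xpsi_r.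
  by rewrite ta tb rmorphM rmorphD rmorphM rmorph_nat.
- move=> p a b q.
  have [->|[t /pair[k [ek el er ta tb]] ->]] := seq_e_cases (p ++ a :: b :: q).
    by rewrite !mulr0.
  have cxx := xx_comm (size p) (size p).+1.
  rewrite (nat_psiE ek) (nat_xE el) (nat_xE er) in cxx *.
  rewrite -rmorph_eval2 // -!rmorphM -expr2 -ta -tb.
  exact: rel_psi2.
- move=> p a b q.
  have [->|[t et ->]] := seq_e_cases (p ++ a :: b :: a :: q).
    by rewrite !mulr0.
  have [k [ek el er ta tb]] := pair _ _ _ _ _ et.
  have et' : tval t = rcons p a ++ b :: a :: q by rewrite cat_rcons.
  have [k' [ek' el' er' _ tc]] := pair _ _ _ _ _ et'.
  rewrite size_rcons in ek' el' er'.
  have c1 := xx_comm (size p) (size p).+1.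
  have c2 := xx_comm (size p).+1 (size p).+2.
  rewrite (nat_psiE ek) (nat_psiE ek') (nat_xE el) (nat_xE er) (nat_xE er') in c1 c2 *.
  rewrite -rmorph_divdiff2 // mulrDl; apply/eqP.
  rewrite addrC -subr_eq -mulrBl; apply/eqP.
  rewrite -!rmorphM -rmorphB -!rmorphM rel_braid.
    by rewrite ta tb tc eqxx.
  by rewrite -ek -ek'.
- move=> a q; have [->|[t et ->]] := seq_e_cases (a :: q); first by rewrite mulr0.
  have sz := size_tuple t; rewrite et /= in sz.
  have N0 : (0 < N)%N by rewrite -sz.
  rewrite (@nat_xE (Ordinal N0)) // -rmorphXn -rmorphM -(rmorph0 f).
  have <- : tnth t (Ordinal N0) = a by rewrite (tnth_nth a) et.
  by apply: rel_cyclotomic.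
Qed.

End MorphEval.

(** * The cyclotomic algebra as a [klr_system], and the theorem *)

Section Instance.
Variables (F : fieldType) (l : nat).
Local Notation I := 'I_l.+1.
Variables (Q : I -> I -> {poly {poly F}}) (L : dom_weight l) (N : nat).

Local Notation rel := (@klr_rel F l Q L N).
Local Notation R := (presented rel).
Local Notation pi := (@presented_pi _ _ rel).

(** The quotient may be the zero ring and so is no [algType]; its structure morphism is built by
    hand. *)
Definition scalar (c : F) : R := c *: (1 : R).

Lemma scalar_is_zmod_morphism : zmod_morphism scalar.
Proof. by move=> c d; rewrite /scalar scalerBl. Qed.

Lemma scalar_is_monoid_morphism : monoid_morphism scalar.
Proof.
split=> [|c d]; first exact: scale1r.
by rewrite /scalar -presented_scalerAl mul1r scalerA.
Qed.

HB.instance Definition _ := GRing.isZmodMorphism.Build F R scalar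
  scalar_is_zmod_morphism.
HB.instance Definition _ := GRing.isMonoidMorphism.Build F R scalar
  scalar_is_monoid_morphism.

Lemma piZ c u : pi (c *: u) = scalar c * pi u.
Proof. by rewrite /scalar -presented_scalerAl mul1r; apply: linearZ. Qed.

Lemma pi_rel u v : rel u v -> pi u = pi v.
Proof. exact: presented_rel. Qed.

Lemma scalar_comm c y : GRing.comm (scalar c) y.
Proof.
by rewrite /GRing.comm /scalar -presented_scalerAl -presented_scalerAr mul1r mulr1.
Qed.

Lemma klr_algebra_system : klr_system Q L (scalar : {rmorphism F -> R})
  (nat_x pi (@free_x F l N)) (nat_psi pi (@free_psi F l N))
  (seq_e pi (@free_e F l N)).
Proof.
apply: klr_system_morph; first exact: piZ.
- by move=> r nu; apply/pi_rel/klr_xe.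
- by move=> k nu; apply/pi_rel/klr_psie.
- by move=> r s; apply/pi_rel/klr_xx.
- by move=> k s ne ne'; apply/pi_rel/klr_psix.
- by move=> k k' lt; apply/pi_rel/klr_psipsi.
- by move=> k nu; apply/pi_rel/klr_xpsi_l.
- by move=> k nu; apply/pi_rel/klr_xpsi_r.
- by move=> k nu; apply/pi_rel/klr_psi2.
- by move=> k k' nu ek; apply/pi_rel/klr_braid.
- by move=> r nu r0; apply/pi_rel/klr_cyclotomic.
- exact: scalar_comm.
Qed.

End Instance.


Theorem lemma2p10 (F : closedFieldType) (l : nat) (hl : (2 <= l)%N)
    (Q : 'I_l.+1 -> 'I_l.+1 -> {poly {poly F}}) (hQ : klr_datum Q)
    (k : 'I_l.+1) (b : rootQ l) :
  block_algebra Q (fund_weight k) b <> [set 0]%classic ->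
  0 <= defect (fund_weight k) b.
Proof.
move=> nz; apply: contrapT => def_lt0; apply: nz.
(* A nonzero $e(\nu)$ of content $\beta$ would make the defect nonnegative, taking all of $\nu$ as
   prefix; so $e(\beta)=0$, and the block vanishes with it. *)
have e0 : klr_e_root Q (fund_weight k) (height b) b = 0.
  rewrite /klr_e_root big1 // => nu /eqP cnu.
  apply: contrapT => enu; apply: def_lt0.
  have sys := klr_algebra_system Q (fund_weight k) (height b).
  have eb : root_sum nu = b by apply: etrans cnu; rewrite /root_sum big_tuple.
  have := defect_prefix_ge0 hl hQ sys (s := nu) (q := [::]).
  by rewrite eb cats0 (seq_eE _ _ (erefl (tval nu))); apply.
apply/seteqP; split=> [x [a _ <-]|x ->] /=; first by rewrite e0 mulr0.
by exists 0 => //; rewrite e0 mulr0.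
Qed.
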